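(* Let $K$ be a real closed field with a compatible non-archimedean absolute value and let $S\subset K^n$ be a semialgebraic set. If $S$ is semialgebraically connected, then $\operatorname{Trop}_r(S)\subset\mathbb{R}^n$ is connected.
   Context: Absolute values take values in $\mathbb{R}_{\ge0}$; a non-archimedean absolute value on an ordered field is compatible with the order if $0\le a\le b$ implies $|a|\le|b|$. A semialgebraic set in $K^n$ is a finite boolean combination of sets $\{f>0\}$, $f\in K[x_1,\dots,x_n]$. $\operatorname{Trop}_r(S)$ is the real tropicalization of $S$: let $M/K$ be an extension of real closed fields, where $M$ carries a compatible non-archimedean absolute value extending that of $K$ with $|M|=\mathbb{R}_{\ge0}$; let $S_M\subset M^n$ be the set given by the same semialgebraic description as $S$; then $\operatorname{Trop}_r(S)=\{(\operatorname{sgn}(x_1)|x_1|,\dots,\operatorname{sgn}(x_n)|x_n|):(x_1,\dots,x_n)\in S_M\}\subset\mathbb{R}^n$. (This set does not depend on the choice of $M$.) $S$ is semialgebraically connected if it is not the disjoint union of two non-empty semialgebraic subsets that are both relatively open in $S$ for the order topology. Connectedness of $\operatorname{Trop}_r(S)$ is with respect to the Euclidean subspace topology. *)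

(* Defs.v *)
From HB Require Import structures.
From mathcomp Require Import all_boot all_order all_algebra.
From mathcomp Require Import boolp classical_sets reals topology normedtype.
(* The notations of mpoly and of normedtype are incompatible, hence the
   filter and the fully applied [mpoly], [meval], [map_mpoly] below. *)
From mathcomp Require Import -(notations) mpoly.

Set Implicit Arguments.
Unset Strict Implicit.
Unset Printing Implicit Defensive.

Import Order.TTheory GRing.Theory Num.Theory.
Import numFieldNormedType.Exports.

Local Open Scope classical_set_scope.
Local Open Scope ring_scope.

(* The trivial absolute value is allowed. *)
Record compatible_nonarch_absval (R : realType) (K : realFieldType)
    (v : K -> R) : Prop := {
  absval_ge0 : forall x, 0 <= v x;
  absval_eq0 : forall x, v x = 0 <-> x = 0;
  absvalM : forall x y, v (x * y) = v x * v y;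
  absval_ultra : forall x y, v (x + y) <= Num.max (v x) (v y);
  absval_compatible : forall x y, 0 <= x -> x <= y -> v x <= v y }.

(* Descriptions of semialgebraic sets: boolean combinations of the conditions
   f > 0. *)
Inductive sa_desc (K : rcfType) (n : nat) : Type :=
| SApos of mpoly n K
| SAnot of sa_desc K n
| SAand of sa_desc K n & sa_desc K n
| SAor of sa_desc K n & sa_desc K n.

Fixpoint sa_holds (K : rcfType) (n : nat) (x : 'rV[K]_n) (phi : sa_desc K n)
    : bool :=
  match phi with
  | SApos f => 0 < meval (fun i => x ord0 i) f
  | SAnot p => ~~ sa_holds x p
  | SAand p q => sa_holds x p && sa_holds x q
  | SAor p q => sa_holds x p || sa_holds x q
  end.

Definition sa_set (K : rcfType) (n : nat) (phi : sa_desc K n)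
    : set 'rV[K]_n := [set x | sa_holds x phi].

Definition semialgebraic (K : rcfType) (n : nat) (S : set 'rV[K]_n) : Prop :=
  exists phi : sa_desc K n, S = sa_set phi.

(* [open] refers to the product topology on 'rV[K]_n, where K carries the
   topology of the balls `|x - y| < e with 0 < e in K, i.e. the order
   topology (and not the topology of any absolute value on K). *)
Definition relatively_open (T : topologicalType) (S A : set T) : Prop :=
  exists2 U : set T, open U & A = S `&` U.

(* As with [connected], the empty set is connected. *)
Definition sa_connected (K : rcfType) (n : nat) (S : set 'rV[K]_n) : Prop :=
  ~ exists A B : set 'rV[K]_n,
      [/\ semialgebraic A /\ semialgebraic B,
          A !=set0 /\ B !=set0,
          relatively_open S A /\ relatively_open S B,
          A `&` B = set0
        & A `|` B = S].

Fixpoint sa_map (K M : rcfType) (iota : {rmorphism K -> M}) (n : nat)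
    (phi : sa_desc K n) : sa_desc M n :=
  match phi with
  | SApos f => SApos (map_mpoly iota f)
  | SAnot p => SAnot (sa_map iota p)
  | SAand p q => SAand (sa_map iota p) (sa_map iota q)
  | SAor p q => SAor (sa_map iota p) (sa_map iota q)
  end.

(* Extensions M/K suitable for computing real tropicalizations. A ring morphism
   between real closed fields is injective and preserves the order. *)
Record trop_extension (R : realType) (K M : rcfType) (v : K -> R)
    (iota : {rmorphism K -> M}) (w : M -> R) : Prop := {
  trop_ext_absval : compatible_nonarch_absval w;
  trop_ext_extends : forall x, w (iota x) = v x;
  trop_ext_surj : forall r : R, 0 <= r -> exists x, w x = r }.

Definition signed_absval (R : realType) (M : rcfType) (w : M -> R) (n : nat)
    (x : 'rV[M]_n) : 'rV[R]_n :=
  \row_i ((sgz (x ord0 i))%:~R * w (x ord0 i)).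

(* By quantifier elimination over real closed fields, this depends only on
   [sa_set phi], and not on the choice of the description [phi]. *)
Definition real_trop (R : realType) (K M : rcfType)
    (iota : {rmorphism K -> M}) (w : M -> R) (n : nat) (phi : sa_desc K n)
    : set 'rV[R]_n :=
  [set signed_absval w x | x in sa_set (sa_map iota phi)].

(* Main.v *)
(** Suppose that [Trop(S) = A u B] with [A], [B] disjoint, nonempty and relatively
    open, and let [f : S_M -> bool] indicate which of the two contains the
    tropicalization of a point. The key claim is that [f] is definable over [M];
    as [f] is locally constant for the order topology, [S_M] is then not
    semialgebraically connected. The existence of such a splitting, the
    parameters of [f] being quantified, is a first-order statement over [K], so
    quantifier elimination, performed uniformly over [K] and [M], yields a
    splitting of [S].

    Definability of [f] is proved by induction on the dimension, for functions
    that are locally constant through the tropicalizations of finitely many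
    definable functions [F_i]. By o-minimality a line is cut into a bounded number
    of intervals on which each [F_i] is continuous and either zero or without
    zeros. On such an interval [f] is constant: if it jumped at a cut of [M], then
    the tropicalizations of the [F_i] would have a limit at that cut, and since
    infima of definable subsets of [M] exist in [M], this limit would be attained
    at some point, whose value of [f] would also be taken on both sides of the
    cut. Definable choice of a point in each interval removes one variable. *)
Require Import Defs.
From HB Require Import structures.
From mathcomp Require Import all_boot all_order all_algebra.
From mathcomp Require Import boolp classical_sets reals topology normedtype.
From mathcomp Require Import -(notations) mpoly.
From mathcomp Require Import polyrcf qe_rcf_th.
From mathcomp Require qe_rcf.
From mathcomp Require Import zify ring lra.

Set Implicit Arguments.
Unset Strict Implicit.
Unset Printing Implicit Defensive.

Import Order.TTheory GRing.Theory Num.Theory.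
Import numFieldNormedType.Exports.
Local Open Scope classical_set_scope.
Local Open Scope ring_scope.

(** * Quantifier elimination, uniformly in the field *)

(** Neither [w] nor, a priori, [f] is definable, and [M] is not Dedekind complete: intervals of [M]
    are full of gaps, and a function that is locally constant for the order topology may well jump
    at one. Jumps are excluded only because [f] is locally constant at the coarser scale of [w], and
    because definable functions have limits at this scale even along a gap that contains no point of
    [M]. Coordinates alone do not support the induction on the dimension. A definable choice [s]
    does not respect tropicalization, so [f (s e :: e)] need not be locally constant in the
    tropicalization of [e]; it is so through the functions [F i (s e :: e)]. Hence the arbitrary
    definable [F i], whose number stays fixed while the dimension drops. To reach a tropical limit
    point by definable means, its preimage is surrounded by boxes that are defined up to a factor
    [t] of [M]: within a factor of absolute value 1, tropicalizations of positive points agree.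
    Quantifier elimination can be uniform because the procedure is purely syntactic and the
    constants it introduces are rational. *)

Notation qf_term := qe_rcf.term.
Notation qf_formula := qe_rcf.formula.

Section MapTerms.

Variables (F G : rcfType) (h : {rmorphism F -> G}).

Fixpoint term_map (t : qf_term F) : qf_term G :=
  match t with
  | qe_rcf.Var i => qe_rcf.Var _ i
  | qe_rcf.Const c => qe_rcf.Const (h c)
  | qe_rcf.NatConst n => qe_rcf.NatConst _ n
  | qe_rcf.Add a b => qe_rcf.Add (term_map a) (term_map b)
  | qe_rcf.Opp a => qe_rcf.Opp (term_map a)
  | qe_rcf.NatMul a n => qe_rcf.NatMul (term_map a) n
  | qe_rcf.Mul a b => qe_rcf.Mul (term_map a) (term_map b)
  | qe_rcf.Exp a n => qe_rcf.Exp (term_map a) n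
  end.

Fixpoint formula_map (f : qf_formula F) : qf_formula G :=
  match f with
  | qe_rcf.Bool b => qe_rcf.Bool b
  | qe_rcf.Equal a b => qe_rcf.Equal (term_map a) (term_map b)
  | qe_rcf.Lt a b => qe_rcf.Lt (term_map a) (term_map b)
  | qe_rcf.Le a b => qe_rcf.Le (term_map a) (term_map b)
  | qe_rcf.And a b => qe_rcf.And (formula_map a) (formula_map b)
  | qe_rcf.Or a b => qe_rcf.Or (formula_map a) (formula_map b)
  | qe_rcf.Implies a b => qe_rcf.Implies (formula_map a) (formula_map b)
  | qe_rcf.Not a => qe_rcf.Not (formula_map a)
  end.

Notation tsmor := (map term_map).
Notation tssmor := (map (map term_map)).

(** The elimination procedure is written in continuation-passing style, so the commutation with [h]
    is always assumed for the continuations [k] and [k'] and propagated to the whole formula. *)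
Lemma fmor_Size p k k' : (forall n, formula_map (k n) = k' n) ->
  formula_map (qe_rcf.Size p k) = qe_rcf.Size (tsmor p) k'.
Proof.
elim: p k k' => [|c p IH] k k' kk' /=; first exact: kk'.
by apply: IH => -[|m] //=; rewrite !kk'.
Qed.

Lemma fmor_Isnull p k k' : (forall n, formula_map (k n) = k' n) ->
  formula_map (qe_rcf.Isnull p k) = qe_rcf.Isnull (tsmor p) k'.
Proof. by move=> kk'; apply: fmor_Size. Qed.

Lemma fmor_LtSize p q k k' : (forall n, formula_map (k n) = k' n) ->
  formula_map (qe_rcf.LtSize p q k) = qe_rcf.LtSize (tsmor p) (tsmor q) k'.
Proof. by move=> kk'; apply: fmor_Size => n; apply: fmor_Size. Qed.

Lemma fmor_LeadCoef p k k' : (forall t, formula_map (k t) = k' (term_map t)) ->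
  formula_map (qe_rcf.LeadCoef p k) = qe_rcf.LeadCoef (tsmor p) k'.
Proof.
elim: p k k' => [|c p IH] k k' kk' /=; first by rewrite kk' /= rmorph0.
by apply: IH => t /=; rewrite !kk'.
Qed.

Lemma tmor_AmulXn t n : tsmor (qe_rcf.AmulXn t n) = qe_rcf.AmulXn (term_map t) n.
Proof. by elim: n => //= n ->; rewrite rmorph0. Qed.

Lemma tmor_AddPoly p q :
  tsmor (qe_rcf.AddPoly p q) = qe_rcf.AddPoly (tsmor p) (tsmor q).
Proof. by elim: p q => [|a p IH] [|b q] //=; rewrite IH. Qed.

Lemma tmor_ScalPoly t p :
  tsmor (qe_rcf.ScalPoly t p) = qe_rcf.ScalPoly (term_map t) (tsmor p).
Proof. by rewrite /qe_rcf.ScalPoly -!map_comp; apply: eq_map. Qed.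

Lemma tmor_MulPoly p q :
  tsmor (qe_rcf.MulPoly p q) = qe_rcf.MulPoly (tsmor p) (tsmor q).
Proof. by elim: p => //= a p IH; rewrite tmor_AddPoly /= tmor_ScalPoly IH. Qed.

Lemma tmor_ExpPoly p n :
  tsmor (qe_rcf.ExpPoly p n) = qe_rcf.ExpPoly (tsmor p) n.
Proof.
case: n => // n; rewrite /qe_rcf.ExpPoly !iteropS.
by elim: n => //= n IH; rewrite tmor_MulPoly IH.
Qed.

Lemma tmor_OppPoly p : tsmor (qe_rcf.OppPoly p) = qe_rcf.OppPoly (tsmor p).
Proof. by rewrite /qe_rcf.OppPoly tmor_ScalPoly /= rmorphN1. Qed.

Lemma tmor_NatMulPoly n p :
  tsmor (qe_rcf.NatMulPoly n p) = qe_rcf.NatMulPoly n (tsmor p).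
Proof. by rewrite /qe_rcf.NatMulPoly tmor_ScalPoly. Qed.

Lemma tmor_Deriv p : tsmor (qe_rcf.Deriv p) = qe_rcf.Deriv (tsmor p).
Proof. by elim: p => //= a p IH; rewrite tmor_AddPoly /= IH. Qed.

Definition tmor_poly := (tmor_AmulXn, tmor_AddPoly, tmor_ScalPoly, tmor_MulPoly,
  tmor_ExpPoly, tmor_OppPoly, tmor_NatMulPoly, tmor_Deriv).

Lemma fmor_Rediv_rec_loop q sq cq c qq r n k k' :
  (forall c qq r, formula_map (k (c, qq, r)) = k' (c, tsmor qq, tsmor r)) ->
  formula_map (qe_rcf.Rediv_rec_loop q sq cq c qq r n k) =
  qe_rcf.Rediv_rec_loop (tsmor q) sq (term_map cq) c (tsmor qq) (tsmor r) n k'.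
Proof.
move=> kk'; elim: n c qq r => [|n IH] c qq r /=; apply: fmor_Size => m;
  case: ifP => // _; apply: fmor_LeadCoef => t; rewrite ?kk' ?IH;
  by rewrite !tmor_poly.
Qed.

Lemma fmor_Rediv p q k k' :
  (forall c qq r, formula_map (k (c, qq, r)) = k' (c, tsmor qq, tsmor r)) ->
  formula_map (qe_rcf.Rediv p q k) = qe_rcf.Rediv (tsmor p) (tsmor q) k'.
Proof.
move=> kk'; apply: fmor_Isnull => -[]; first by rewrite kk' /= rmorph0.
apply: fmor_Size => sq; apply: fmor_Size => sp; apply: fmor_LeadCoef => lq.
by rewrite (fmor_Rediv_rec_loop _ _ _ _ _ _ _ kk') /= rmorph0.
Qed.

Lemma fmor_Rmod p q k k' : (forall r, formula_map (k r) = k' (tsmor r)) ->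
  formula_map (qe_rcf.Rmod p q k) = qe_rcf.Rmod (tsmor p) (tsmor q) k'.
Proof. by move=> kk'; apply: fmor_Rediv => c qq r /=. Qed.

Lemma fmor_Rscal p q k k' : (forall r, formula_map (k r) = k' r) ->
  formula_map (qe_rcf.Rscal p q k) = qe_rcf.Rscal (tsmor p) (tsmor q) k'.
Proof. by move=> kk'; apply: fmor_Rediv => c qq r /=. Qed.

Lemma fmor_Rgcd_loop n p q k k' : (forall r, formula_map (k r) = k' (tsmor r)) ->
  formula_map (qe_rcf.Rgcd_loop n p q k) = qe_rcf.Rgcd_loop n (tsmor p) (tsmor q) k'.
Proof.
move=> kk'; elim: n p q => [|n IH] p q /=; apply: fmor_Rmod => r;
  by apply: fmor_Isnull => -[].
Qed.

Lemma fmor_Rgcd p q k k' : (forall r, formula_map (k r) = k' (tsmor r)) ->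
  formula_map (qe_rcf.Rgcd p q k) = qe_rcf.Rgcd (tsmor p) (tsmor q) k'.
Proof.
move=> kk'; apply: fmor_LtSize => -[]; apply: fmor_Isnull => -[] //;
  by apply: fmor_Size => n; apply: fmor_Rgcd_loop.
Qed.

Lemma fmor_BigRgcd ps k k' : (forall r, formula_map (k r) = k' (tsmor r)) ->
  formula_map (qe_rcf.BigRgcd ps k) = qe_rcf.BigRgcd (tssmor ps) k'.
Proof.
elim: ps k k' => [|p ps IH] k k' kk' /=; first by rewrite kk' /= rmorph0.
by apply: IH => r; apply: fmor_Rgcd.
Qed.

Lemma fmor_Changes s k k' : (forall n, formula_map (k n) = k' n) ->
  formula_map (qe_rcf.Changes s k) = qe_rcf.Changes (tsmor s) k'.
Proof.
elim: s k k' => [|a s IH] k k' kk' /=; first exact: kk'.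
by apply: IH => n /=; rewrite !kk'; case: (s).
Qed.

Lemma fmor_SeqPInfty ps k k' : (forall s, formula_map (k s) = k' (tsmor s)) ->
  formula_map (qe_rcf.SeqPInfty ps k) = qe_rcf.SeqPInfty (tssmor ps) k'.
Proof.
elim: ps k k' => [|p ps IH] k k' kk' /=; first exact: kk'.
by apply: fmor_LeadCoef => t; apply: IH => s; rewrite kk'.
Qed.

Lemma fmor_SeqMInfty ps k k' : (forall s, formula_map (k s) = k' (tsmor s)) ->
  formula_map (qe_rcf.SeqMInfty ps k) = qe_rcf.SeqMInfty (tssmor ps) k'.
Proof.
elim: ps k k' => [|p ps IH] k k' kk' /=; first exact: kk'.
apply: fmor_LeadCoef => t; apply: fmor_Size => n; apply: IH => s.
by rewrite kk' /= rmorphN1.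
Qed.

Lemma fmor_ChangesPoly ps k k' : (forall n, formula_map (k n) = k' n) ->
  formula_map (qe_rcf.ChangesPoly ps k) = qe_rcf.ChangesPoly (tssmor ps) k'.
Proof.
move=> kk'; apply: fmor_SeqMInfty => m; apply: fmor_SeqPInfty => p.
by apply: fmor_Changes => vm; apply: fmor_Changes => vp.
Qed.

Lemma fmor_NextMod p q k k' : (forall s, formula_map (k s) = k' (tsmor s)) ->
  formula_map (qe_rcf.NextMod p q k) = qe_rcf.NextMod (tsmor p) (tsmor q) k'.
Proof.
move=> kk'; apply: fmor_LeadCoef => t; apply: fmor_Rscal => n.
by apply: fmor_Rmod => r; rewrite kk' tmor_ScalPoly.
Qed.

Lemma fmor_ModsAux p q n k k' : (forall s, formula_map (k s) = k' (tssmor s)) ->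
  formula_map (qe_rcf.ModsAux p q n k) = qe_rcf.ModsAux (tsmor p) (tsmor q) n k'.
Proof.
elim: n p q k k' => [|n IH] p q k k' kk' /=; first exact: kk'.
apply: fmor_Isnull => -[]; first exact: kk'.
by apply: fmor_NextMod => r; apply: IH => s; rewrite kk'.
Qed.

Lemma fmor_Mods p q k k' : (forall s, formula_map (k s) = k' (tssmor s)) ->
  formula_map (qe_rcf.Mods p q k) = qe_rcf.Mods (tsmor p) (tsmor q) k'.
Proof.
move=> kk'; apply: fmor_Size => n; apply: fmor_Size => m.
exact: fmor_ModsAux.
Qed.

Lemma tsmor_nth ps i : tsmor (nth [::] ps i) = nth [::] (tssmor ps) i.
Proof. by elim: ps i => [|p ps IH] [|i] /=. Qed.

Lemma tmor_PolyComb sq sc :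
  tsmor (qe_rcf.PolyComb sq sc) = qe_rcf.PolyComb (tssmor sq) sc.
Proof.
rewrite /qe_rcf.PolyComb size_map; elim: (iota _ _) => //= i s IH.
by rewrite tmor_MulPoly IH tmor_ExpPoly tsmor_nth.
Qed.

Lemma tmor_Pcq sq i : tsmor (qe_rcf.Pcq sq i) = qe_rcf.Pcq (tssmor sq) i.
Proof.
rewrite /qe_rcf.Pcq tsmor_nth -map_comp size_map; congr (nth _ _ _).
by apply: eq_map => x /=; rewrite tmor_PolyComb.
Qed.

Lemma fmor_TaqR p q k k' : (forall n, formula_map (k n) = k' n) ->
  formula_map (qe_rcf.TaqR p q k) = qe_rcf.TaqR (tsmor p) (tsmor q) k'.
Proof.
move=> kk'; rewrite /qe_rcf.TaqR -tmor_Deriv -tmor_MulPoly.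
by apply: fmor_Mods => r; apply: fmor_ChangesPoly.
Qed.

Lemma fmor_TaqsR p sq i k k' : (forall t, formula_map (k t) = k' (term_map t)) ->
  formula_map (qe_rcf.TaqsR p sq i k) = qe_rcf.TaqsR (tsmor p) (tssmor sq) i k'.
Proof.
move=> kk'; rewrite /qe_rcf.TaqsR -tmor_Pcq.
by apply: fmor_TaqR => n; rewrite kk' /= rmorph_int.
Qed.

(** These constants are entries of the inverse of an integer matrix. They are rational, hence
    respected by every morphism of fields. *)
Lemma tmor_Coefs n i : term_map (qe_rcf.Coefs F n i) = qe_rcf.Coefs G n i.
Proof.
rewrite /qe_rcf.Coefs /=; congr qe_rcf.Const.
case: n => [|[|n]]; first by rewrite rmorph_nat.
  by case: i => [|[|[|i]]]; rewrite /= ?nth_nil ?fmorphV ?rmorph_nat ?rmorph0.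
rewrite /coefs; set s1 := map _ _; set s2 := map _ _.
suff -> : s2 = map h s1.
  by elim: s1 i => [|a s IH] [|i] /=; rewrite ?rmorph0.
rewrite /s1 /s2 -[RHS]map_comp; apply: eq_map => j /=.
rewrite !castmxE; set A := ctmat _.
have -> : map_mx (intr : int -> G) A = map_mx h (map_mx (intr : int -> F) A).
  by apply/matrixP => a b; rewrite !mxE rmorph_int.
by rewrite -map_invmx mxE.
Qed.

Lemma fmor_CcountWeak p sq k k' : (forall t, formula_map (k t) = k' (term_map t)) ->
  formula_map (qe_rcf.CcountWeak p sq k) = qe_rcf.CcountWeak (tsmor p) (tssmor sq) k'.
Proof.
move=> kk'; rewrite /qe_rcf.CcountWeak size_map.
have -> : qe_rcf.NatConst G 0 = term_map (qe_rcf.NatConst F 0) by [].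
elim: (3 ^ _)%N (qe_rcf.NatConst F 0) => [|n IH] t /=; first exact: kk'.
by apply: fmor_TaqsR => u; rewrite IH -tmor_Coefs.
Qed.

Lemma tmor_BoundingPoly sq :
  tsmor (qe_rcf.BoundingPoly sq) = qe_rcf.BoundingPoly (tssmor sq).
Proof.
rewrite /qe_rcf.BoundingPoly tmor_Deriv; congr qe_rcf.Deriv.
by elim: sq => //= p sq IH; rewrite tmor_MulPoly IH.
Qed.

(** [CcountGt0] decides whether [sp] has a common zero at which all of [sq] are positive. If [sp]
    vanishes identically, the test points are the two infinities and the zeros of the derivative of
    the product of [sq], which by Rolle meet every gap between roots. *)
Lemma fmor_CcountGt0 sp sq :
  formula_map (qe_rcf.CcountGt0 sp sq) = qe_rcf.CcountGt0 (tssmor sp) (tssmor sq).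
Proof.
apply: fmor_BigRgcd => p; apply: fmor_Isnull => -[] /=; last first.
  exact: fmor_CcountWeak.
rewrite -tmor_BoundingPoly.
apply: fmor_CcountWeak => t /=; congr (qe_rcf.Or _ (qe_rcf.Or _ _)).
  elim: sq => //= q sq ->; congr qe_rcf.And.
  exact: fmor_LeadCoef.
elim: sq => //= q sq ->; congr qe_rcf.And.
by apply: fmor_Size => n; apply: fmor_LeadCoef.
Qed.

Lemma tmor_abstrX i t : tsmor (qe_rcf.abstrX i t) = qe_rcf.abstrX i (term_map t).
Proof.
elim: t => //=.
- by move=> n; case: eqP.
- by move=> a <- b <-; rewrite tmor_AddPoly.
- by move=> a <-; rewrite tmor_OppPoly.
- by move=> a <- n; rewrite tmor_NatMulPoly.
- by move=> a <- b <-; rewrite tmor_MulPoly.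
- by move=> a <- n; rewrite tmor_ExpPoly.
Qed.

End MapTerms.

(** * Substitution, disjunctive normal forms and elimination of one variable *)

Section Substitution.

Variable F : rcfType.

Fixpoint term_subst (s : nat -> qf_term F) (t : qf_term F) : qf_term F :=
  match t with
  | qe_rcf.Var i => s i
  | qe_rcf.Const c => qe_rcf.Const c
  | qe_rcf.NatConst n => qe_rcf.NatConst _ n
  | qe_rcf.Add a b => qe_rcf.Add (term_subst s a) (term_subst s b)
  | qe_rcf.Opp a => qe_rcf.Opp (term_subst s a)
  | qe_rcf.NatMul a n => qe_rcf.NatMul (term_subst s a) n
  | qe_rcf.Mul a b => qe_rcf.Mul (term_subst s a) (term_subst s b)
  | qe_rcf.Exp a n => qe_rcf.Exp (term_subst s a) n
  end.

Fixpoint formula_subst (s : nat -> qf_term F) (f : qf_formula F) : qf_formula F :=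
  match f with
  | qe_rcf.Bool b => qe_rcf.Bool b
  | qe_rcf.Equal a b => qe_rcf.Equal (term_subst s a) (term_subst s b)
  | qe_rcf.Lt a b => qe_rcf.Lt (term_subst s a) (term_subst s b)
  | qe_rcf.Le a b => qe_rcf.Le (term_subst s a) (term_subst s b)
  | qe_rcf.And a b => qe_rcf.And (formula_subst s a) (formula_subst s b)
  | qe_rcf.Or a b => qe_rcf.Or (formula_subst s a) (formula_subst s b)
  | qe_rcf.Implies a b => qe_rcf.Implies (formula_subst s a) (formula_subst s b)
  | qe_rcf.Not a => qe_rcf.Not (formula_subst s a)
  end.

Lemma eval_tsub s t e e' : (forall i, e'`_i = qe_rcf.eval e (s i)) ->
  qe_rcf.eval e (term_subst s t) = qe_rcf.eval e' t.
Proof.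
by move=> se; elim: t => //= [a -> b ->|a ->|a -> n|a -> b ->|a -> n].
Qed.

Lemma eval_fsub s f e e' : (forall i, e'`_i = qe_rcf.eval e (s i)) ->
  qe_rcf.qf_eval e (formula_subst s f) = qe_rcf.qf_eval e' f.
Proof.
move=> se; elim: f => //= [a b|a b|a b|a -> b ->|a -> b ->|a -> b ->|a ->] //;
  by rewrite !(eval_tsub _ se).
Qed.

(* [dnf b f] is a disjunctive normal form of [f] or, if [~~ b], of its negation:
   the terms of the first components vanish, those of the second ones are
   positive. *)
Fixpoint dnf (b : bool) (f : qf_formula F) : seq (seq (qf_term F) * seq (qf_term F)) :=
  let conj f1 f2 := [seq (c.1 ++ d.1, c.2 ++ d.2) | c <- f1, d <- f2] in
  let sub x y := qe_rcf.Add x (qe_rcf.Opp y) in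
  match f with
  | qe_rcf.Bool c => if b == c then [:: ([::], [::])] else [::]
  | qe_rcf.Equal x y =>
      if b then [:: ([:: sub x y], [::])]
      else [:: ([::], [:: sub x y]); ([::], [:: sub y x])]
  | qe_rcf.Lt x y =>
      if b then [:: ([::], [:: sub y x])]
      else [:: ([:: sub x y], [::]); ([::], [:: sub x y])]
  | qe_rcf.Le x y =>
      if b then [:: ([:: sub x y], [::]); ([::], [:: sub y x])]
      else [:: ([::], [:: sub x y])]
  | qe_rcf.And f g =>
      if b then conj (dnf b f) (dnf b g) else dnf b f ++ dnf b g
  | qe_rcf.Or f g =>
      if b then dnf b f ++ dnf b g else conj (dnf b f) (dnf b g)
  | qe_rcf.Implies f g =>
      if b then dnf (~~ b) f ++ dnf b g else conj (dnf (~~ b) f) (dnf b g)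
  | qe_rcf.Not f => dnf (~~ b) f
  end.

(** Once the variable 0 has been turned into the indeterminate of polynomials, the other indices
    drop by one; the freed index receives the dummy value 0. *)
Definition elim_var0 (f : qf_formula F) : qf_formula F :=
  formula_subst (fun i => if i is i'.+1 then qe_rcf.Var _ i' else qe_rcf.Const 0)
    (foldr (fun c => qe_rcf.Or
         (qe_rcf.CcountGt0 (map (qe_rcf.abstrX 0) c.1)
                           (map (qe_rcf.abstrX 0) c.2)))
       (qe_rcf.Bool false) (dnf true f)).

End Substitution.

Lemma tmor_id (F : rcfType) (t : qf_term F) : term_map idfun t = t.
Proof. by elim: t => //= [a -> b ->|a ->|a -> n|a -> b ->|a -> n]. Qed.

Lemma fmor_id (F : rcfType) (f : qf_formula F) : formula_map idfun f = f.
Proof.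
by elim: f => //= [a b|a b|a b|a -> b ->|a -> b ->|a -> b ->|a ->];
  rewrite ?tmor_id.
Qed.

Section ElimMorph.

Variables (F G : rcfType) (h : {rmorphism F -> G}).

Lemma tmor_tsub s t : term_map h (term_subst s t) = term_subst (term_map h \o s) (term_map h t).
Proof. by elim: t => //= [a -> b ->|a ->|a -> n|a -> b ->|a -> n]. Qed.

Lemma fmor_fsub s f : formula_map h (formula_subst s f) = formula_subst (term_map h \o s) (formula_map h f).
Proof.
elim: f => //= [a b|a b|a b|a -> b ->|a -> b ->|a -> b ->|a ->] //;
  by rewrite !tmor_tsub.
Qed.

Definition sat_conj e (c : seq (qf_term F) * seq (qf_term F)) :=
  all (fun t => qe_rcf.eval e (term_map h t) == 0) c.1 &&
  all (fun t => 0 < qe_rcf.eval e (term_map h t)) c.2.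

Lemma has_conj e f1 f2 :
  has (sat_conj e) [seq (c.1 ++ d.1, c.2 ++ d.2) | c <- f1, d <- f2] =
  has (sat_conj e) f1 && has (sat_conj e) f2.
Proof.
elim: f1 => //= c f1 IH; rewrite has_cat IH andb_orl; congr orb.
elim: f2 {IH} => [|d f2 IH] /=; first by rewrite andbF.
rewrite IH andb_orr; congr orb; rewrite /sat_conj /= !all_cat.
by rewrite -!andbA; congr andb; rewrite andbCA.
Qed.

Lemma dnfP e b f :
  has (sat_conj e) (dnf b f) = (b == qe_rcf.qf_eval e (formula_map h f)).
Proof.
elim: f b => //=.
- by move=> c b; case: eqP.
- move=> x y [] /=; rewrite /sat_conj /= ?orbF ?andbT ?subr_eq0 ?subr_gt0;
  by case: ltgtP.
- move=> x y [] /=; rewrite /sat_conj /= ?orbF ?andbT ?subr_eq0 ?subr_gt0;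
  by case: ltgtP.
- move=> x y [] /=; rewrite /sat_conj /= ?orbF ?andbT ?subr_eq0 ?subr_gt0;
  by case: ltgtP.
- move=> f1 IH1 f2 IH2 []; rewrite ?has_conj ?has_cat !(IH1, IH2);
  by do 2 case: qe_rcf.qf_eval.
- move=> f1 IH1 f2 IH2 []; rewrite ?has_conj ?has_cat !(IH1, IH2);
  by do 2 case: qe_rcf.qf_eval.
- move=> f1 IH1 f2 IH2 []; rewrite ?has_conj ?has_cat !(IH1, IH2);
  by do 2 case: qe_rcf.qf_eval.
- by move=> f1 IH1 b; rewrite IH1; case: b; case: qe_rcf.qf_eval.
Qed.

(** The elimination takes place over [F], while the environment [e] and the witness [y] live in [G]
    and may lie outside the image of [h]: this is the uniformity needed for the transfer. Existence
    distributes over the disjuncts, and each of them is a system of equations and strict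
    inequalities in one variable. *)
Lemma elim_var0P e f :
  qe_rcf.qf_eval e (formula_map h (elim_var0 f)) <->
  exists y, qe_rcf.qf_eval (y :: e) (formula_map h f).
Proof.
rewrite fmor_fsub (@eval_fsub _ _ _ _ (0 :: e)); last by case=> //=; rewrite rmorph0.
have -> : (exists y, qe_rcf.qf_eval (y :: e) (formula_map h f)) <->
          exists y, has (sat_conj (y :: e)) (dnf true f).
  by split=> -[y H]; exists y; move: H; rewrite dnfP; case: qe_rcf.qf_eval.
elim: (dnf true f) => [|c cs IH] /=; first by split=> // -[].
have Hc : qe_rcf.qf_eval (0 :: e) (formula_map h (qe_rcf.CcountGt0
     (map (qe_rcf.abstrX 0) c.1) (map (qe_rcf.abstrX 0) c.2))) <->
   exists y, sat_conj (y :: e) c.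
  rewrite fmor_CcountGt0 qe_rcf.eval_CcountGt0.
  apply: (iff_trans (iff_sym (rwP (ccount_gt0P _ _)))).
  suff E y : sat_conj (y :: e) c =
      (\big[andb/true]_(p <- map (map (term_map h)) (map (qe_rcf.abstrX 0) c.1)) 
         ((qe_rcf.eval_poly (0 :: e) p).[y] == 0)) &&
      (\big[andb/true]_(p <- map (map (term_map h)) (map (qe_rcf.abstrX 0) c.2)) 
         (0 < (qe_rcf.eval_poly (0 :: e) p).[y])).
    by split=> -[y H]; exists y; move: H; rewrite E !(big_map, map_comp).
  rewrite !big_map !big_all /sat_conj; congr andb; apply: eq_all => t /=;
  by rewrite tmor_abstrX qe_rcf.abstrXP.
split=> [/orP [/Hc [y H]|/IH [y H]]|[y /orP [H|H]]].
- by exists y; rewrite H.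
- by exists y; rewrite H orbT.
- by apply/orP; left; apply/Hc; exists y.
- by apply/orP; right; apply/IH; exists y.
Qed.

End ElimMorph.

(** * Sets given by one formula over two fields *)

Section PairDef.

Variables (F G : rcfType) (h : {rmorphism F -> G}).

(* Points are sequences, implicitly padded with zeros; [definable_pair A B] says that [A]
   and [B] are defined by the same quantifier-free formula with constants in [F]. *)
Definition polynomial_pair (s : seq F -> F) (t : seq G -> G) :=
  exists u : qf_term F, (forall e, s e = qe_rcf.eval e u) /\
                   (forall e, t e = qe_rcf.eval e (term_map h u)).

Definition definable_pair (A : seq F -> Prop) (B : seq G -> Prop) :=
  exists f : qf_formula F, (forall e, A e <-> qe_rcf.qf_eval e f) /\
                   (forall e, B e <-> qe_rcf.qf_eval e (formula_map h f)).

(** Only entries are compared, because lists count up to padding by zeros; a term for every index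
    allows environments of unbounded length. *)
Definition subst_pair (s : seq F -> seq F) (t : seq G -> seq G) :=
  exists u : nat -> qf_term F, (forall e i, (s e)`_i = qe_rcf.eval e (u i)) /\
              (forall e i, (t e)`_i = qe_rcf.eval e (term_map h (u i))).

Lemma pterm_const c : polynomial_pair (fun=> c) (fun=> h c).
Proof. by exists (qe_rcf.Const c). Qed.

Lemma pterm_nat n : polynomial_pair (fun=> n%:R) (fun=> n%:R).
Proof. by exists (qe_rcf.NatConst _ n). Qed.

Lemma pterm_nth s t i : subst_pair s t -> polynomial_pair (fun e => (s e)`_i) (fun e => (t e)`_i).
Proof. by move=> [u [us ut]]; exists (u i). Qed.

Lemma ptermD s t s' t' : polynomial_pair s t -> polynomial_pair s' t' ->
  polynomial_pair (fun e => s e + s' e) (fun e => t e + t' e).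
Proof.
move=> [u [us ut]] [u' [us' ut']]; exists (qe_rcf.Add u u').
by split=> e /=; rewrite ?(us, us', ut, ut').
Qed.

Lemma ptermN s t : polynomial_pair s t -> polynomial_pair (fun e => - s e) (fun e => - t e).
Proof. by move=> [u [us ut]]; exists (qe_rcf.Opp u); split=> e /=; rewrite ?(us, ut). Qed.

Lemma ptermB s t s' t' : polynomial_pair s t -> polynomial_pair s' t' ->
  polynomial_pair (fun e => s e - s' e) (fun e => t e - t' e).
Proof. by move=> st st'; apply: ptermD => //; apply: ptermN. Qed.

Lemma ptermM s t s' t' : polynomial_pair s t -> polynomial_pair s' t' ->
  polynomial_pair (fun e => s e * s' e) (fun e => t e * t' e).
Proof.
move=> [u [us ut]] [u' [us' ut']]; exists (qe_rcf.Mul u u').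
by split=> e /=; rewrite ?(us, us', ut, ut').
Qed.

Lemma psub_id : subst_pair id id.
Proof. by exists (qe_rcf.Var _). Qed.

Lemma psub_behead s t :
  subst_pair s t -> subst_pair (fun e => behead (s e)) (fun e => behead (t e)).
Proof.
move=> [u [us ut]]; exists (fun i => u i.+1).
by split=> e i /=; rewrite nth_behead ?us ?ut.
Qed.

Lemma psub_comp s t s' t' : subst_pair s t -> subst_pair s' t' ->
  subst_pair (fun e => s (s' e)) (fun e => t (t' e)).
Proof.
move=> [u [us ut]] [u' [us' ut']]; exists (fun i => term_subst u' (u i)).
split=> e i; first by rewrite us (eval_tsub _ (us' e)).
by rewrite ut tmor_tsub (eval_tsub _ (ut' e)).
Qed.

Lemma psub_drop n s t :
  subst_pair s t -> subst_pair (fun e => drop n (s e)) (fun e => drop n (t e)).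
Proof.
move=> [u [us ut]]; exists (fun i => u (n + i)%N).
by split=> e i /=; rewrite nth_drop ?us ?ut.
Qed.

Lemma psub_cons s t s' t' : polynomial_pair s t -> subst_pair s' t' ->
  subst_pair (fun e => s e :: s' e) (fun e => t e :: t' e).
Proof.
move=> [u [us ut]] [u' [us' ut']].
exists (fun i => if i is i'.+1 then u' i' else u).
by split=> e [|i] /=; rewrite ?(us, us', ut, ut').
Qed.

Lemma pdef_iff A B A' B' : (forall e, A e <-> A' e) -> (forall e, B e <-> B' e) ->
  definable_pair A B -> definable_pair A' B'.
Proof.
move=> AA BB [f [fA fB]]; exists f; split=> e.
  by rewrite -fA; split=> /AA.
by rewrite -fB; split=> /BB.
Qed.

Lemma pdef_bool (b : bool) : definable_pair (fun=> b) (fun=> b).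
Proof. by exists (qe_rcf.Bool b). Qed.

Lemma pdef_lt s t s' t' : polynomial_pair s t -> polynomial_pair s' t' ->
  definable_pair (fun e => s e < s' e) (fun e => t e < t' e).
Proof.
move=> [u [us ut]] [u' [us' ut']]; exists (qe_rcf.Lt u u').
by split=> e /=; rewrite ?(us, us', ut, ut').
Qed.

Lemma pdef_le s t s' t' : polynomial_pair s t -> polynomial_pair s' t' ->
  definable_pair (fun e => s e <= s' e) (fun e => t e <= t' e).
Proof.
move=> [u [us ut]] [u' [us' ut']]; exists (qe_rcf.Le u u').
by split=> e /=; rewrite ?(us, us', ut, ut').
Qed.

Lemma pdef_eq s t s' t' : polynomial_pair s t -> polynomial_pair s' t' ->
  definable_pair (fun e => s e = s' e) (fun e => t e = t' e).
Proof.
move=> [u [us ut]] [u' [us' ut']]; exists (qe_rcf.Equal u u').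
by split=> e /=; rewrite ?(us, us', ut, ut'); split=> /eqP.
Qed.

Lemma pdef_and A B A' B' : definable_pair A B -> definable_pair A' B' ->
  definable_pair (fun e => A e /\ A' e) (fun e => B e /\ B' e).
Proof.
move=> [f [fA fB]] [f' [fA' fB']]; exists (qe_rcf.And f f').
split=> e /=; first by rewrite fA fA'; split=> /andP.
by rewrite fB fB'; split=> /andP.
Qed.

Lemma pdef_not A B : definable_pair A B -> definable_pair (fun e => ~ A e) (fun e => ~ B e).
Proof.
move=> [f [fA fB]]; exists (qe_rcf.Not f).
split=> e /=; first by rewrite fA; split=> /negP.
by rewrite fB; split=> /negP.
Qed.

Lemma pdef_or A B A' B' : definable_pair A B -> definable_pair A' B' ->
  definable_pair (fun e => A e \/ A' e) (fun e => B e \/ B' e).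
Proof.
move=> [f [fA fB]] [f' [fA' fB']]; exists (qe_rcf.Or f f').
split=> e /=; first by rewrite fA fA'; split=> /orP.
by rewrite fB fB'; split=> /orP.
Qed.

Lemma pdef_imp A B A' B' : definable_pair A B -> definable_pair A' B' ->
  definable_pair (fun e => A e -> A' e) (fun e => B e -> B' e).
Proof.
move=> [f [fA fB]] [f' [fA' fB']]; exists (qe_rcf.Implies f f').
split=> e /=; first by rewrite fA fA'; split=> /implyP.
by rewrite fB fB'; split=> /implyP.
Qed.

Lemma pdef_equiv A B A' B' : definable_pair A B -> definable_pair A' B' ->
  definable_pair (fun e => A e <-> A' e) (fun e => B e <-> B' e).
Proof. by move=> AB AB'; apply: pdef_and; apply: pdef_imp. Qed.

Lemma pdef_sub A B s t : definable_pair A B -> subst_pair s t ->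
  definable_pair (fun e => A (s e)) (fun e => B (t e)).
Proof.
move=> [f [fA fB]] [u [us ut]]; exists (formula_subst u f); split=> e.
  by rewrite fA (eval_fsub _ (us e)).
by rewrite fB fmor_fsub (eval_fsub _ (ut e)).
Qed.

Lemma pdef_ex (P : seq F -> F -> Prop) (Q : seq G -> G -> Prop) :
  definable_pair (fun e => P (behead e) e`_0) (fun e => Q (behead e) e`_0) ->
  definable_pair (fun e => exists y, P e y) (fun e => exists y, Q e y).
Proof.
move=> [f [fA fB]]; exists (elim_var0 f); split=> e; last first.
  by rewrite elim_var0P; split=> -[y H]; exists y; apply/(fB (y :: e)).
(* The statement over [F] is the case of the identity morphism. *)
rewrite -[elim_var0 f]fmor_id elim_var0P fmor_id.
by split=> -[y H]; exists y; apply/(fA (y :: e)).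
Qed.

Lemma pdef_all (P : seq F -> F -> Prop) (Q : seq G -> G -> Prop) :
  definable_pair (fun e => P (behead e) e`_0) (fun e => Q (behead e) e`_0) ->
  definable_pair (fun e => forall y, P e y) (fun e => forall y, Q e y).
Proof.
move=> /pdef_not /(@pdef_ex (fun e y => ~ P e y) (fun e y => ~ Q e y)) /pdef_not.
apply: pdef_iff => e;
  by split=> [H y|H [y]]; [apply: contrapT => ?; apply: H; exists y|apply].
Qed.

Lemma pdef_ball n (P : nat -> seq F -> Prop) (Q : nat -> seq G -> Prop) :
  (forall i, (i < n)%N -> definable_pair (P i) (Q i)) ->
  definable_pair (fun e => forall i, (i < n)%N -> P i e)
       (fun e => forall i, (i < n)%N -> Q i e).
Proof.
elim: n => [|n IH] H; first by apply: pdef_iff (pdef_bool true).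
have := pdef_and (IH (fun i ni => H i (ltnW ni))) (H n (leqnn _)).
apply: pdef_iff => e; split=> [[H1 H2] i|H1].
- by rewrite ltnS leq_eqVlt => /orP [/eqP ->|]; [|exact: H1].
- by split=> [i ni|]; apply: H1 => //; apply: ltnW.
- by rewrite ltnS leq_eqVlt => /orP [/eqP ->|]; [|exact: H1].
- by split=> [i ni|]; apply: H1 => //; apply: ltnW.
Qed.

End PairDef.

(** * Definable sets and functions *)

Section Definable.

Variable M : rcfType.
Implicit Types (A B : seq M -> Prop) (s t : seq M -> M) (g : seq M -> seq M).

Definition definable A := definable_pair (@idfun M) A A.
Definition definable_subst g := subst_pair (@idfun M) g g.
Definition definable_fun t := definable (fun e => e`_0 = t (behead e)).

Lemma defP A : definable A <-> exists f, forall e, A e <-> qe_rcf.qf_eval e f.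
Proof.
split=> [[f [fA _]]|[f fA]]; exists f => //.
by rewrite fmor_id; split.
Qed.

Lemma dsub_id : definable_subst (fun e => e). Proof. exact: psub_id. Qed.

Lemma dsub_behead g : definable_subst g -> definable_subst (fun e => behead (g e)).
Proof. exact: psub_behead. Qed.

Lemma dsub_const e : definable_subst (fun=> e).
Proof. by exists (fun i => qe_rcf.Const e`_i). Qed.

Lemma dsub_consn g g' i : definable_subst g -> definable_subst g' -> definable_subst (fun e => (g e)`_i :: g' e).
Proof. by move=> dg dg'; apply: psub_cons => //; apply: pterm_nth. Qed.

Lemma dsub_consc c g : definable_subst g -> definable_subst (fun e => c :: g e).
Proof. by move=> dg; apply: psub_cons => //; apply: (pterm_const (@idfun M) c). Qed.

Lemma def_iff A B : (forall e, A e <-> B e) -> definable A -> definable B.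
Proof. by move=> AB; apply: pdef_iff. Qed.

Lemma def_and A B : definable A -> definable B -> definable (fun e => A e /\ B e).
Proof. exact: pdef_and. Qed.

Lemma def_or A B : definable A -> definable B -> definable (fun e => A e \/ B e).
Proof. exact: pdef_or. Qed.

Lemma def_not A : definable A -> definable (fun e => ~ A e).
Proof. exact: pdef_not. Qed.

Lemma def_imp A B : definable A -> definable B -> definable (fun e => A e -> B e).
Proof. exact: pdef_imp. Qed.

Lemma def_const (P : Prop) : definable (fun=> P).
Proof. by apply: (def_iff _ (pdef_bool _ `[<P>])) => _; split=> /asboolP. Qed.

Lemma def_sub A g : definable A -> definable_subst g -> definable (fun e => A (g e)).
Proof. exact: pdef_sub. Qed.

Lemma def_ex (P : seq M -> M -> Prop) :
  definable (fun e => P (behead e) e`_0) -> definable (fun e => exists y, P e y).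
Proof. exact: pdef_ex. Qed.

Lemma def_all (P : seq M -> M -> Prop) :
  definable (fun e => P (behead e) e`_0) -> definable (fun e => forall y, P e y).
Proof. exact: pdef_all. Qed.

Lemma def_ball n (P : seq M -> nat -> Prop) :
  (forall i, (i < n)%N -> definable (fun e => P e i)) ->
  definable (fun e => forall i, (i < n)%N -> P e i).
Proof. exact: (@pdef_ball _ _ _ n (fun i e => P e i) (fun i e => P e i)). Qed.

Lemma dsub_comp g g' : definable_subst g -> definable_subst g' -> definable_subst (fun e => g (g' e)).
Proof. exact: psub_comp. Qed.

Lemma dfun_sub t g : definable_fun t -> definable_subst g -> definable_fun (fun e => t (g e)).
Proof.
move=> dt dg.
apply: (def_sub (g := fun e => e`_0 :: g (behead e)) dt).
apply: dsub_consn; first exact: dsub_id.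
by apply: (dsub_comp dg); apply: dsub_behead; exact: dsub_id.
Qed.

Lemma dfun_nth g i : definable_subst g -> definable_fun (fun e => (g e)`_i).
Proof.
move=> dg; apply: pdef_eq; first exact: pterm_nth (psub_id _).
apply: pterm_nth; apply: (psub_comp dg); apply: psub_behead; exact: psub_id.
Qed.

Lemma dfun_const c : definable_fun (fun=> c).
Proof. by apply: pdef_eq; [exact: pterm_nth (psub_id _)|exact: pterm_const]. Qed.

(** A definable function need not be a term, so it is substituted by quantifying over its graph. *)
Lemma def_app t (P : seq M -> M -> Prop) : definable_fun t ->
  definable (fun e => P (behead e) e`_0) -> definable (fun e => P e (t e)).
Proof.
move=> dt dP.
have: definable (fun e => exists y, y = t e /\ P e y) by apply: def_ex; apply: def_and.
by apply: def_iff => e; split=> [[_ [-> //]]|Pt]; exists (t e).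
Qed.

Let dsub_bb : definable_subst (fun e => behead (behead e)).
Proof. by do 2 apply: dsub_behead; exact: dsub_id. Qed.

Lemma def_app2 s t (P : M -> M -> Prop) : definable_fun s -> definable_fun t ->
  definable (fun e => P e`_0 e`_1) -> definable (fun e => P (s e) (t e)).
Proof.
move=> ds dt dP; apply: (@def_app s (fun e x => P x (t e))) => //.
apply: (@def_app (fun e => t (behead e)) (fun e y => P e`_0 y)).
  by apply: dfun_sub => //; apply: dsub_behead; exact: dsub_id.
apply: (def_sub (g := fun e => (behead e)`_0 :: e) dP).
by apply: dsub_consn; [apply: dsub_behead|]; exact: dsub_id.
Qed.

Lemma dfun_cons t F g : definable_fun t -> definable_fun F -> definable_subst g ->
  definable_fun (fun e => F (t e :: g e)).
Proof.
move=> dt dF dg; rewrite /definable_fun.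
apply: (@def_app (fun e => t (behead e)) (fun e y => e`_0 = F (y :: g (behead e)))).
  by apply: dfun_sub => //; apply: dsub_behead; exact: dsub_id.
apply: (def_sub (g := fun e => (behead e)`_0 :: e`_0 :: g (behead (behead e))) dF).
apply: dsub_consn; first by apply: dsub_behead; exact: dsub_id.
by apply: dsub_consn; [exact: dsub_id|exact: (dsub_comp dg)].
Qed.

Lemma def_cons t A g : definable_fun t -> definable A -> definable_subst g -> definable (fun e => A (t e :: g e)).
Proof.
move=> dt dA dg; apply: (@def_app t (fun e y => A (y :: g e)) dt).
apply: (def_sub (g := fun e => e`_0 :: g (behead e)) dA).
apply: dsub_consn; first exact: dsub_id.
by apply: (dsub_comp dg); apply: dsub_behead; exact: dsub_id.
Qed.

Let nth_pair i : polynomial_pair (@idfun M) (fun e => e`_i) (fun e => e`_i).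
Proof. exact: pterm_nth (psub_id _). Qed.

Lemma def_lt s t : definable_fun s -> definable_fun t -> definable (fun e => s e < t e).
Proof. by move=> ds dt; apply: (@def_app2 _ _ (fun x y => x < y)) => //; exact: pdef_lt. Qed.

Lemma def_le s t : definable_fun s -> definable_fun t -> definable (fun e => s e <= t e).
Proof. by move=> ds dt; apply: (@def_app2 _ _ (fun x y => x <= y)) => //; exact: pdef_le. Qed.

Lemma def_eq s t : definable_fun s -> definable_fun t -> definable (fun e => s e = t e).
Proof. by move=> ds dt; apply: (@def_app2 _ _ (fun x y => x = y)) => //; exact: pdef_eq. Qed.

Let dfun_op2 (op : M -> M -> M) s t : definable_fun s -> definable_fun t ->
  definable (fun e => e`_0 = op e`_1 e`_2) -> definable_fun (fun e => op (s e) (t e)).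
Proof.
move=> ds dt dop; rewrite /definable_fun.
apply: (@def_app (fun e => s (behead e)) (fun e y => e`_0 = op y (t (behead e)))).
  by apply: dfun_sub => //; apply: dsub_behead; exact: dsub_id.
apply: (@def_app (fun e => t (behead (behead e)))
                 (fun e y => (behead e)`_0 = op e`_0 y)).
  exact: dfun_sub.
apply: (def_sub (g := fun e => (behead (behead e))`_0 :: (behead e)`_0 :: e) dop).
apply: dsub_consn; first exact: dsub_bb.
by apply: dsub_consn; [apply: dsub_behead|]; exact: dsub_id.
Qed.

Lemma dfunD s t : definable_fun s -> definable_fun t -> definable_fun (fun e => s e + t e).
Proof. by move=> ds dt; apply: dfun_op2 => //; apply: pdef_eq => //; exact: ptermD. Qed.

Lemma dfunM s t : definable_fun s -> definable_fun t -> definable_fun (fun e => s e * t e).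
Proof. by move=> ds dt; apply: dfun_op2 => //; apply: pdef_eq => //; exact: ptermM. Qed.

Lemma dfunN s : definable_fun s -> definable_fun (fun e => - s e).
Proof.
move=> ds; apply: (@dfun_op2 (fun x _ => - x) s s) => //.
by apply: pdef_eq => //; exact: ptermN.
Qed.

Lemma dfun_norm s : definable_fun s -> definable_fun (fun e => `|s e|).
Proof.
move=> ds; apply: (@dfun_op2 (fun x _ => `|x|) s s) => //.
have d i : definable_fun (fun e => e`_i) by apply: dfun_nth; exact: dsub_id.
have: definable (fun e => 0 <= e`_1 /\ e`_0 = e`_1 \/ e`_1 < 0 /\ e`_0 = - e`_1).
  apply: def_or; apply: def_and; rewrite ?(def_le, def_lt) //.
  - by apply: def_le => //; exact: dfun_const.
  - exact: def_eq.
  - by apply: def_lt => //; exact: dfun_const.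
  - by apply: def_eq => //; exact: dfunN.
apply: def_iff => e; have [e0|e0] := ger0P e`_1.
  by split=> [[[]|[]] //|->]; by left.
by split=> [[[]|[]] //|->]; by right.
Qed.

End Definable.

Arguments def_app {M t} P.

Ltac dsub_tac := cbv beta;
  lazymatch goal with
  | |- definable_subst (fun e => e) => exact: dsub_id
  | |- definable_subst behead => exact: (dsub_behead (dsub_id _))
  | |- definable_subst (fun e => behead _) => apply: dsub_behead; dsub_tac
  | |- definable_subst (fun e => nth 0 _ _ :: _) => apply: dsub_consn; dsub_tac
  | |- _ => first [exact: dsub_const | apply: dsub_consc; dsub_tac]
  end.

Ltac dfun_tac := cbv beta;
  lazymatch goal with
  | |- definable_fun (fun e => nth 0 _ _) => apply: dfun_nth; dsub_tac
  | |- definable_fun (fun e => _ + _) => apply: dfunD; dfun_tac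
  | |- definable_fun (fun e => - _) => apply: dfunN; dfun_tac
  | |- definable_fun (fun e => _ * _) => apply: dfunM; dfun_tac
  | |- definable_fun (fun e => `|_|) => apply: dfun_norm; dfun_tac
  | |- _ => try first [assumption | exact: dfun_const]
  end.

Ltac def_tac := cbv beta;
  lazymatch goal with
  | |- definable (fun e => _ /\ _) => apply: def_and; def_tac
  | |- definable (fun e => _ \/ _) => apply: def_or; def_tac
  | |- definable (fun e => ~ _) => apply: def_not; def_tac
  | |- definable (fun e => is_true (_ < _)) => apply: def_lt; dfun_tac
  | |- definable (fun e => is_true (_ <= _)) => apply: def_le; dfun_tac
  | |- definable (fun e => _ = _) => apply: def_eq; dfun_tac
  | |- definable (fun e => exists y, @?P e y) => apply: (@def_ex _ P); def_tac
  | |- definable (fun e => forall i : nat, _ -> _) => apply: def_ball => ? ?; def_tac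
  | |- definable (fun e => forall y : _, _) =>
      first [ apply: def_imp; [def_tac | def_tac]
            | apply: def_all; def_tac ]
  | |- _ => try first [assumption | exact: def_const]
  end.

(** * O-minimality *)

Section Ominimal.

Variable M : rcfType.
Implicit Types (A B : seq M -> Prop) (P Q : M -> Prop) (a b c x y z r s u v : M).

Definition avoids (Z : seq M) (a b : M) := forall z, z \in Z -> ~~ (a <= z <= b).

Lemma avoids_cat Z Z' a b : avoids (Z ++ Z') a b -> avoids Z a b /\ avoids Z' a b.
Proof. by move=> H; split=> z zZ; apply: H; rewrite mem_cat zZ ?orbT. Qed.

Lemma avoids_sub Z a b a' b' : a <= a' -> b' <= b -> avoids Z a b -> avoids Z a' b'.
Proof.
move=> aa bb H z /H; apply: contra => /andP[h1 h2].
by rewrite (le_trans aa h1) (le_trans h2 bb).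
Qed.

(** The exceptional points are the roots of [t] as a polynomial in its first variable. Its number of
    coefficients does not depend on [e], whence the uniform [N]; if all coefficients vanish at [e],
    the sign is constantly 0. Between roots the intermediate value theorem applies. *)
Lemma term_sign_finite (t : qf_term M) : exists N, forall e, exists Z : seq M,
  (size Z <= N)%N /\ forall a b, a <= b -> avoids Z a b ->
    Num.sg (qe_rcf.eval (a :: e) t) = Num.sg (qe_rcf.eval (b :: e) t).
Proof.
exists (size (qe_rcf.abstrX 0 t)) => e.
set p := qe_rcf.eval_poly (0 :: e) (qe_rcf.abstrX 0 t).
have pE y : qe_rcf.eval (y :: e) t = p.[y] by rewrite /p qe_rcf.abstrXP.
exists (rootsR p); split.
  have [->|p0] := eqVneq p 0; first by rewrite rootsR0.
  apply: (@leq_trans (size p)); last by rewrite /p qe_rcf.eval_polyP (leq_trans (size_Poly _)) ?size_map.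
  apply/ltnW/max_poly_roots => //; last exact: uniq_roots.
  by apply/allP => x; apply: root_roots.
move=> a b ab av; rewrite !pE.
have [->|p0] := eqVneq p 0; first by rewrite !horner0.
apply: (@polyrN0_itv _ `[a, b]); rewrite ?in_itv /= ?lexx ?ab // => y.
rewrite in_itv /= => yab; apply/negP => ry.
have /roots_on_rootsR /(_ y) := p0; rewrite ry in_itv /= => /esym /av.
by rewrite yab.
Qed.

Lemma formula_finite (f : qf_formula M) : exists N, forall e, exists Z : seq M,
  (size Z <= N)%N /\ forall a b, a <= b -> avoids Z a b ->
    qe_rcf.qf_eval (a :: e) f = qe_rcf.qf_eval (b :: e) f.
Proof.
have comp (Rel : M -> M -> bool) (x y : qf_term M) :
    (forall u v u' v', Num.sg (u - v) = Num.sg (u' - v') -> Rel u v = Rel u' v') ->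
    exists N, forall e, exists Z : seq M, (size Z <= N)%N /\
    forall a b, a <= b -> avoids Z a b ->
    Rel (qe_rcf.eval (a :: e) x) (qe_rcf.eval (a :: e) y) =
    Rel (qe_rcf.eval (b :: e) x) (qe_rcf.eval (b :: e) y).
  move=> H; have [N HN] := term_sign_finite (qe_rcf.Add x (qe_rcf.Opp y)).
  exists N => e; have [Z [sZ HZ]] := HN e; exists Z; split=> // a b ab av.
  by apply: H; apply: (HZ _ _ ab av).
have bin (op : bool -> bool -> bool) (f1 f2 : qf_formula M) :
  (exists N, forall e, exists Z : seq M, (size Z <= N)%N /\
    forall a b, a <= b -> avoids Z a b ->
      qe_rcf.qf_eval (a :: e) f1 = qe_rcf.qf_eval (b :: e) f1) ->
  (exists N, forall e, exists Z : seq M, (size Z <= N)%N /\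
    forall a b, a <= b -> avoids Z a b ->
      qe_rcf.qf_eval (a :: e) f2 = qe_rcf.qf_eval (b :: e) f2) ->
  exists N, forall e, exists Z : seq M, (size Z <= N)%N /\
    forall a b, a <= b -> avoids Z a b ->
      op (qe_rcf.qf_eval (a :: e) f1) (qe_rcf.qf_eval (a :: e) f2) =
      op (qe_rcf.qf_eval (b :: e) f1) (qe_rcf.qf_eval (b :: e) f2).
  move=> [N1 H1] [N2 H2]; exists (N1 + N2)%N => e.
  have [Z1 [s1 HZ1]] := H1 e; have [Z2 [s2 HZ2]] := H2 e.
  exists (Z1 ++ Z2); rewrite size_cat leq_add //; split=> // a b ab.
  by move=> /avoids_cat [/HZ1 -> // /HZ2 -> //].
elim: f => /=.
- by move=> c; exists 0%N => e; exists [::].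
- move=> x y; apply: (comp (fun u v => u == v)) => u v u' v' uv.
  by rewrite -subr_eq0 -sgr_eq0 uv sgr_eq0 subr_eq0.
- move=> x y; apply: (comp (fun u v => u < v)) => u v u' v' uv.
  by rewrite -subr_lt0 -sgr_lt0 uv sgr_lt0 subr_lt0.
- move=> x y; apply: (comp (fun u v => u <= v)) => u v u' v' uv.
  by rewrite -subr_le0 -sgr_le0 uv sgr_le0 subr_le0.
- by move=> f1 H1 f2 H2; apply: (bin andb).
- by move=> f1 H1 f2 H2; apply: (bin orb).
- by move=> f1 H1 f2 H2; apply: (bin implb).
- by move=> f1 H1; apply: (bin (fun p _ => ~~ p) f1 f1).
Qed.

Lemma def_finite A : definable A -> exists N, forall e, exists Z : seq M,
  (size Z <= N)%N /\ forall a b, a <= b -> avoids Z a b -> (A (a :: e) <-> A (b :: e)).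
Proof.
move=> /defP [f fA]; have [N HN] := formula_finite f; exists N => e.
have [Z [sZ HZ]] := HN e; exists Z; split=> // a b ab av.
by rewrite !fA (HZ a b).
Qed.

Definition definable1 P := definable (fun e => P e`_0).

Lemma def1_finite P : definable1 P ->
  exists Z : seq M, forall a b, a <= b -> avoids Z a b -> (P a <-> P b).
Proof. by move=> /def_finite [N /(_ [::]) [Z [_ HZ]]]; exists Z. Qed.

Lemma half_between (a b : M) : a < b -> a < (a + b) / 2 < b.
Proof. by move=> ab; apply/andP; split; lra. Qed.

Lemma finite_gap_left (Z : seq M) a b : a < b ->
  exists a', [/\ a < a', a' < b & forall z, z \in Z -> z < b -> z < a'].
Proof.
move=> ab; elim: Z => [|z Z [a' [h1 h2 h3]]].
  by exists ((a + b) / 2); have /andP[] := half_between ab.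
have [zb|bz] := ltP z b; last first.
  exists a'; split=> // x; rewrite inE => /orP[/eqP->|/h3 //].
  by rewrite ltNge bz.
have mb : Num.max a' z < b by rewrite gt_max h2.
exists ((Num.max a' z + b) / 2); have /andP[m1 m2] := half_between mb.
have [h4 h5] : a' <= Num.max a' z /\ z <= Num.max a' z by rewrite !le_max !lexx orbT.
split=> //; first by apply: lt_trans m1; apply: lt_le_trans h4.
move=> x; rewrite inE => /orP[/eqP->|/h3 h xb]; first by move=> _; apply: le_lt_trans m1.
by apply: lt_trans (h xb) _; apply: le_lt_trans m1.
Qed.

Lemma finite_gap_right (Z : seq M) a b : a < b ->
  exists b', [/\ a < b', b' < b & forall z, z \in Z -> a < z -> b' < z].
Proof.
move=> ab; have nab : - b < - a by rewrite ltrN2.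
have [c [h1 h2 h3]] := finite_gap_left (map -%R Z) nab.
exists (- c); split; [by rewrite ltrNr|by rewrite ltrNl|] => z zZ az.
by rewrite ltrNl; apply: h3; rewrite ?ltrN2 // map_f.
Qed.

Lemma finite_avoid (Z : seq M) a b : a < b ->
  exists a' b', [/\ a < a', a' < b', b' < b & avoids Z a' b'].
Proof.
move=> ab; have [a' [h1 h2 h3]] := finite_gap_left Z ab.
have /andP[m1 m2] := half_between h2.
exists a', ((a' + b) / 2); split=> // z zZ; apply/negP => /andP[z1 z2].
have /(h3 _ zZ) : z < b by apply: le_lt_trans m2.
by rewrite ltNge z1.
Qed.

Lemma def1_subinterval P a b : definable1 P -> a < b ->
  exists a' b', [/\ a < a', a' < b' & b' < b] /\
   ((forall x, a' <= x <= b' -> P x) \/ (forall x, a' <= x <= b' -> ~ P x)).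
Proof.
move=> /def1_finite [Z HZ] /(finite_avoid Z) [a' [b' [h1 h2 h3 h4]]].
exists a', b'; split=> //; have [Pa|nPa] := pselect (P a'); [left|right] => x /andP[x1 x2].
  by apply/(HZ a' x) => //; apply: avoids_sub h4.
by move=> /(HZ a' x x1 (avoids_sub _ x2 h4)) => /(_ (lexx _)).
Qed.

(* [L] is the lower part of a gap of [M]. *)
Lemma def1_gap P (L : M -> Prop) : definable1 P ->
  (forall x y, x <= y -> L y -> L x) -> (exists x, L x) -> (exists x, ~ L x) ->
  (forall x, L x -> exists2 y, L y & x < y) ->
  (forall x, ~ L x -> exists2 y, ~ L y & y < x) ->
  exists l u, [/\ L l, ~ L u & forall x y, l <= x <= u -> l <= y <= u -> (P x <-> P y)].
Proof.
move=> /def1_finite [Z HZ] Ldown exL exU noMax noMin.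
have [l [Ll lZ]] : exists l, L l /\ forall z, z \in Z -> L z -> z < l.
  elim: {HZ} Z => [|z Z [l [Ll lZ]]]; first by have [l] := exL; exists l.
  have [Lz|nLz] := pselect (L z); last first.
    by exists l; split=> // x; rewrite inE => /orP[/eqP->|/lZ].
  have [l' Ll' ll'] := noMax _ Ll; have [z' Lz' zz'] := noMax _ Lz.
  exists (Num.max l' z'); split; first by case: leP.
  move=> x; rewrite inE lt_max => /orP[/eqP->|/lZ H /H xl]; first by rewrite zz' orbT.
  by rewrite (lt_trans xl ll').
have [u [Lu uZ]] : exists u, ~ L u /\ forall z, z \in Z -> ~ L z -> u < z.
  elim: {HZ lZ} Z => [|z Z [u [Lu uZ]]]; first by have [u] := exU; exists u.
  have [Lz|nLz] := pselect (L z).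
    by exists u; split=> // x; rewrite inE => /orP[/eqP->|/uZ].
  have [u' Lu' uu'] := noMin _ Lu; have [z' Lz' zz'] := noMin _ nLz.
  exists (Num.min u' z'); split; first by case: leP.
  move=> x; rewrite inE gt_min => /orP[/eqP->|/uZ H /H xl]; first by rewrite zz' orbT.
  by rewrite (lt_trans uu' xl).
exists l, u; split=> //.
have av : avoids Z l u.
  move=> z zZ; apply/negP => /andP[z1 z2].
  have [Lz|nLz] := pselect (L z); first by have := lZ _ zZ Lz; rewrite ltNge z1.
  by have := uZ _ zZ nLz; rewrite ltNge z2.
move=> x y /andP[x1 x2] /andP[y1 y2]; have [xy|/ltW yx] := leP x y.
  by apply: HZ => //; apply: avoids_sub av.
by apply: iff_sym; apply: HZ => //; apply: avoids_sub av.
Qed.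

(** Without a supremum, the set [L] of points lying strictly below some point of [P] would be the
    lower part of a gap. As [L] is itself definable, [def1_gap] makes it constant across that gap,
    which is absurd. *)
Lemma def1_sup P : definable1 P -> (exists x, P x) -> (exists u, forall x, P x -> x <= u) ->
  exists s, (forall x, P x -> x <= s) /\ (forall u, u < s -> exists2 x, P x & u < x).
Proof.
move=> dP exP [v vP].
pose L x := exists y, P y /\ x < y.
have Lw x : L x -> exists2 y, L y & x < y.
  move=> [y [Py xy]]; have /andP[h1 h2] := half_between xy.
  by exists ((x + y) / 2) => //; exists y.
have [[s [nLs smin]]|nmin] := pselect (exists s, ~ L s /\ forall x, ~ L x -> s <= x).
  exists s; split=> [x Px|u us].
    by rewrite leNgt; apply/negP => sx; apply: nLs; exists x.
  have [[y [Py uy]]|/smin] := pselect (L u); first by exists y.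
  by rewrite leNgt us.
have dL : definable1 L.
  rewrite /definable1 /L; def_tac.
have [|||||l [u [Ll nLu H]]] := @def1_gap L L dL.
- by move=> x y xy [z [Pz yz]]; exists z; split=> //; apply: le_lt_trans yz.
- by have [x Px] := exP; exists (x - 1), x; split=> //; lra.
- by exists v => -[y [/vP yv]]; rewrite ltNge yv.
- exact: Lw.
- move=> x nLx; apply: contrapT => H; apply: nmin; exists x; split=> // y nLy.
  by rewrite leNgt; apply/negP => yx; apply: H; exists y.
have lu : l <= u.
  rewrite leNgt; apply/negP => ul; apply: (nLu); have [y [Py ly]] := Ll.
  by exists y; split=> //; apply: lt_trans ly.
by case: nLu; apply/(H l u); rewrite ?lexx ?lu.
Qed.

(** The classical supremum argument: suprema of definable sets exist, and the set of the [x] such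
    that [P] holds on [[a, x]] is definable with [P]. *)
Lemma def1_connected P a b : definable1 P -> a <= b ->
  (forall x, a <= x <= b -> exists2 r, 0 < r &
     forall y, a <= y <= b -> `|y - x| < r -> (P y <-> P x)) ->
  P a -> P b.
Proof.
move=> dP ab loc Pa.
pose Q x := (a <= x /\ x <= b) /\ forall y, a <= y /\ y <= x -> P y.
have dQ : definable1 Q.
  rewrite /definable1 /Q; def_tac.
have Qa : Q a by split=> // y [y1 y2]; have -> : y = a by apply/eqP; rewrite eq_le y1 y2.
have [||s [s1 s2]] := def1_sup dQ; first by exists a.
  by exists b => x [[]].
have sb : s <= b by rewrite leNgt; apply/negP => /s2 [x [[_ xb] _]]; rewrite ltNge xb.
have sa : a <= s by exact: s1.
have sab : a <= s <= b by rewrite sa sb.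
have [r r0 Hr] := loc _ sab.
have [x [[xa xb] Qx] sx] : exists2 x, Q x & s - r < x by apply: s2; lra.
have xs : x <= s by apply: s1.
have Ps : P s.
  have Hx : `|x - s| < r by rewrite ler0_norm; lra.
  have xab : a <= x <= b by rewrite xa.
  by apply/(Hr x xab Hx); apply: Qx.
have [->//|nsb] := eqVneq b s.
have sltb : s < b by rewrite lt_neqAle eq_sym nsb.
pose t := Num.min b (s + r / 2).
have [tb ts st] : [/\ t <= b, t <= s + r / 2 & s < t].
  by rewrite /t lt_min sltb !ge_min !lexx orbT; split=> //; lra.
have : Q t.
  split=> [|y [y1 y2]]; first by split=> //; lra.
  have [ysr|ysr] := ltP y (s - r).
    by apply: Qx; split=> //; lra.
  have [ye|yne] := eqVneq y (s - r).
    by apply: Qx; split=> //; lra.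
  apply/Hr => //; first by rewrite y1 (le_trans y2).
  have : s - r < y by rewrite lt_neqAle eq_sym yne.
  by move=> ?; rewrite ltr_norml; apply/andP; split; lra.
by move=> /s1; rewrite leNgt st.
Qed.

(* The uniform bound on the number of isolated points of the sections of [A]
   replaces a Baire category argument. *)
Lemma def_baire (A : M -> M -> Prop) a b : definable (fun e => A e`_0 e`_1) -> a < b ->
  (forall r s y, 0 < r -> r <= s -> A s y -> A r y) ->
  (forall y, a <= y <= b -> exists2 r, 0 < r & A r y) ->
  exists r a' b', [/\ 0 < r, a < a', a' < b', b' < b &
     forall y, a' <= y <= b' -> A r y].
Proof.
move=> dA ab mono cover.
have [N HN] : exists N, forall e, exists Z : seq M, (size Z <= N)%N /\
    forall x y, x <= y -> avoids Z x y -> (A e x <-> A e y).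
  have [N HN] := def_finite (A := fun e => A e`_1 e`_0) (def_sub (g := fun e => e`_1 :: e) dA
    (dsub_consn 1 (dsub_id _) (dsub_id _))).
  by exists N => e; apply: (HN [:: e]).
apply: contrapT => H.
(* These are [N + 1] distinct interior points, one more than a section can have exceptional points.
   For a common small [r] all of them satisfy [A r], so a point among them that is not exceptional
   yields an interval on its left. *)
pose pts := [seq a + (b - a) * (i.+1%:R / N.+2%:R) | i <- iota 0 N.+1].
have ptsU : uniq pts.
  have ba : b - a != 0 by rewrite subr_eq0 gt_eqF.
  have N2 : (N.+2%:R : M)^-1 != 0 by rewrite invr_eq0 pnatr_eq0.
  rewrite map_inj_in_uniq ?iota_uniq // => i j _ _ /addrI /(mulfI ba) /(mulIf N2).
  by move/eqP; rewrite eqr_nat eqSS => /eqP.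
have ptsab y : y \in pts -> a < y < b.
  move=> /mapP [i]; rewrite mem_iota /= add0n => iN ->.
  have i0 : (0 : M) < i.+1%:R / N.+2%:R by rewrite divr_gt0 ?ltr0n.
  have i1 : i.+1%:R / N.+2%:R < (1 : M) by rewrite ltr_pdivrMr ?ltr0n // mul1r ltr_nat ltnS.
  have ab0 : 0 < b - a by rewrite subr_gt0.
  by rewrite ltrDl mulr_gt0 //= -ltrBrDl gtr_pMr.
have [r r0 Hr] : exists2 r, 0 < r & forall y, y \in pts -> A r y.
  elim: pts {ptsU} ptsab => [|y s IH] sab; first by exists 1.
  have [z zs|r r0 Hr] := IH; first by apply: sab; rewrite inE zs orbT.
  have /andP[y1 y2] := sab y (mem_head _ _).
  have [|r' r'0 Hr'] := cover y; first by rewrite !ltW.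
  have m0 : 0 < Num.min r r' by rewrite lt_min r0.
  exists (Num.min r r') => // z; rewrite inE => /orP[/eqP->|/Hr].
    by apply: mono Hr' => //; rewrite ge_min lexx orbT.
  by apply: mono => //; rewrite ge_min lexx.
have [Z [sZ HZ]] := HN r.
suff : (size pts <= size Z)%N by rewrite size_map size_iota; lia.
apply: uniq_leq_size => // y yp; apply: contrapT => /negP yZ.
have /andP[y1 y2] := ptsab _ yp.
have [c [c1 c2 c3]] := finite_gap_left Z y1.
have /andP[m1 m2] := half_between c2.
apply: H; exists r, c, ((c + y) / 2); split=> //; first exact: lt_trans y2.
move=> x /andP[x1 x2]; apply/(HZ x y); [lra| |exact: Hr].
move=> z zZ; apply/negP => /andP[z1]; rewrite le_eqVlt => /orP[/eqP zy|/(c3 _ zZ)].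
  by move: yZ; rewrite -zy zZ.
by lra.
Qed.

End Ominimal.

(** * Generic continuity and definable choice *)

Section Continuity.

Variable M : rcfType.
Implicit Types (A B : seq M -> Prop) (P Q : M -> Prop) (a b c x y z r s u v : M).
Implicit Types (F : M -> M).

Definition definable_fun1 F := definable_fun (fun e => F e`_0).

Definition continuous_at F x := forall r, 0 < r -> exists d, 0 < d /\
  forall y, `|y - x| < d -> `|F y - F x| < r.

Lemma def_continuous_at (F : seq M -> M) :
  definable_fun F -> definable (fun e => continuous_at (fun y => F (y :: behead e)) e`_0).
Proof.
move=> dF; rewrite /continuous_at; def_tac; apply: (dfun_sub dF); dsub_tac.
Qed.

Lemma dfun1P (F : seq M -> M) e : definable_fun F -> definable_fun1 (fun y => F (y :: e)).
Proof. by move=> dF; apply: (dfun_sub dF); apply: dsub_consn; dsub_tac. Qed.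

Lemma def1P A e : definable A -> definable1 (fun y => A (y :: e)).
Proof. by move=> dA; apply: (def_sub dA); apply: dsub_consn; dsub_tac. Qed.

(** Otherwise [F] is discontinuous everywhere on some subinterval. Two applications of [def_baire]
    bound [F] and bound its oscillation from below by a fixed [r1] on a smaller one. But a bounded
    definable function has a left limit at the right end, so its oscillation becomes small there. *)
Lemma dfun1_continuous F a b : definable_fun1 F -> a < b ->
  exists a' b', [/\ a < a', a' < b', b' < b & forall x, a' <= x <= b' -> continuous_at F x].
Proof.
move=> dF ab.
have dFg g i : definable_subst g -> definable_fun (fun e => F (g e)`_i).
  by move=> dg; apply: (dfun_sub (g := fun e => (g e)`_i :: e) dF); apply: dsub_consn => //; dsub_tac.
have dC : definable1 (continuous_at F).
  by rewrite /definable1 /continuous_at; def_tac; apply: dFg; dsub_tac.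
have [a1 [b1 [[a01 ab1 b01] [H|ncont]]]] := def1_subinterval dC ab.
  by exists a1, b1.
exfalso.
(* The bound on [F] is the inverse of [r], so that the condition gets weaker as [r] decreases, as
   [def_baire] requires. *)
have [||y _|r0 [a2 [b2 [r0_gt0 a12 ab2 b12 bnd]]]] :=
    @def_baire _ (fun r y => `|F y| * r <= 1) a1 b1 _ ab1.
- by def_tac; apply: dFg; dsub_tac.
- by move=> r s y r0 rs; apply: le_trans; rewrite ler_wpM2l.
- exists (`|F y| + 1)^-1; first by rewrite invr_gt0; apply: ltr_wpDl.
  by rewrite ler_pdivrMr ?mul1r ?lerDl //; apply: ltr_wpDl.
have [||y yab|r1 [a3 [b3 [r1_gt0 a23 ab3 b23 disc]]]] := @def_baire _
    (fun r y => forall d, 0 < d -> exists z, `|z - y| < d /\ r <= `|F z - F y|) a2 b2 _ ab2.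
- by def_tac; apply: dFg; dsub_tac.
- move=> r s y r_gt0 rs H d /H [z [z1 z2]]; exists z; split=> //.
  exact: le_trans z2.
- have /ncont : a1 <= y <= b1 by lra.
  move=> H; apply: contrapT => nr; apply: H => r r_gt0; apply: contrapT => nd.
  apply: nr; exists r => // d d0; apply: contrapT => nz; apply: nd.
  exists d; split=> // z zd; rewrite ltNge; apply/negP => rz; apply: nz.
  by exists z.
(* The supremum [s] of [U] is the lower limit of [F] from the left at [b3]. By o-minimality [F]
   stays below [s + r1 / 4] close to [b3] as soon as this value is not in [U], so all values there
   differ by at most [r1 / 2]. *)
pose U u := exists c, c < b3 /\ forall y, c < y /\ y < b3 -> u < F y.
have dU : definable1 U by rewrite /definable1 /U; def_tac; apply: dFg; dsub_tac.
have FB y : a3 <= y <= b3 -> - r0^-1 <= F y <= r0^-1.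
  move=> yab; rewrite -ler_norml -[r0^-1]mul1r ler_pdivlMr //.
  by apply: bnd; lra.
have [||s [s1 s2]] := def1_sup dU.
- exists (- r0^-1 - 1), a3; split=> // y [y1 y2].
  have /andP[+ _] : - r0^-1 <= F y <= r0^-1 by apply: FB; lra.
  by move=> ?; lra.
- exists r0^-1 => u [c [cb Hc]].
  have cb3 : Num.max c a3 < b3 by rewrite gt_max cb.
  have /andP[m1 m2] := half_between cb3; move: m1; rewrite gt_max => /andP[m1 m3].
  have /ltW := Hc _ (conj m1 m2); move=> /le_trans; apply.
  by have /FB /andP[_ ->] : a3 <= (Num.max c a3 + b3) / 2 <= b3 by rewrite !ltW.
have [|u1 [c1 [c1b Hc1]] u1s] := s2 (s - r1 / 4); first by lra.
have nU2 : ~ U (s + r1 / 4) by move=> /s1; lra.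
have [|Z HZ] := @def1_finite _ (fun y => s + r1 / 4 < F y).
  by rewrite /definable1; def_tac; apply: dFg; dsub_tac.
have [c2 [c21 c2b c2Z]] := finite_gap_left Z ab3.
have le2 y : c2 <= y < b3 -> F y <= s + r1 / 4.
  move=> /andP[y1 y2]; rewrite leNgt; apply/negP => yF; apply: nU2.
  exists c2; split=> // z [z1 z2].
  have av u v : c2 <= u -> v < b3 -> avoids Z u v.
    move=> uc vb w wZ; apply/negP => /andP[w1 w2].
    by have := c2Z _ wZ (le_lt_trans w2 vb); lra.
  have [yz|zy] := leP y z; first by apply/(HZ y z) => //; apply: av.
  by apply/(HZ z y) => //; [exact: ltW|apply: av => //; exact: ltW].
have cb : Num.max c1 c2 < b3 by rewrite gt_max c1b.
have /andP[m1 m2] := half_between cb; set y := (_ + b3) / 2 in m1 m2.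
have d0 : 0 < Num.min (y - Num.max c1 c2) (b3 - y) by rewrite lt_min !subr_gt0 m1.
have close z : Num.max c1 c2 < z < b3 -> s - r1 / 4 < F z <= s + r1 / 4.
  rewrite gt_max => /andP[/andP[z1 z2] z3]; apply/andP; split.
    by apply: lt_trans u1s _; apply: Hc1.
  by apply: le2; rewrite z3 ltW.
have [|z [zy rF]] := disc y _ _ d0.
  by move: m1; rewrite gt_max => /andP[_ ?]; lra.
have zin : Num.max c1 c2 < z < b3.
  by move: zy; rewrite lt_min !ltr_norml => /andP[/andP[? ?] /andP[? ?]]; lra.
have /close /andP[y1 y2] : Num.max c1 c2 < y < b3 by rewrite m1.
have /andP[z1 z2] := close _ zin.
by move: rF; rewrite leNgt ltr_norml => /negP; apply; lra.
Qed.

Lemma finite_max (Z : seq M) P : (exists2 z, z \in Z & P z) ->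
  exists p, [/\ p \in Z, P p & forall z, z \in Z -> P z -> z <= p].
Proof.
elim: Z => [|z Z IH] [x] //; rewrite inE => xZ Px.
have [/IH [p [pZ Pp pmax]]|nP] := pselect (exists2 z, z \in Z & P z); last first.
  exists z; case/orP: xZ => [/eqP xz|xZ]; last by case: nP; exists x.
  split; [by rewrite mem_head|by rewrite -xz|move=> y; rewrite inE].
  by move=> /orP[/eqP->//|yZ Py]; case: nP; exists y.
have [[Pz pz]|H] := pselect (P z /\ p < z).
  exists z; split=> //; first exact: mem_head.
  move=> y; rewrite inE => /orP[/eqP-> //|yZ /pmax H].
  by apply: le_trans (ltW pz); apply: H.
exists p; split=> //; first by rewrite inE pZ orbT.
move=> y; rewrite inE => /orP[/eqP-> Pz|]; last exact: pmax.
by rewrite leNgt; apply/negP => pz; apply: H.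
Qed.

Lemma finite_min (Z : seq M) P : (exists2 z, z \in Z & P z) ->
  exists p, [/\ p \in Z, P p & forall z, z \in Z -> P z -> p <= z].
Proof.
move=> [x xZ Px]; have [|p [pZ Pp pmax]] := @finite_max (map -%R Z) (fun z => P (- z)).
  by exists (- x); rewrite ?opprK ?map_f.
exists (- p); split=> //; first by case/mapP: pZ => y yZ ->; rewrite opprK.
move=> z zZ Pz; rewrite lerNl; apply: pmax; last by rewrite opprK.
exact: map_f.
Qed.

Definition boundary P p := forall r, 0 < r ->
  (exists y, `|y - p| < r /\ P y) /\ (exists y, `|y - p| < r /\ ~ P y).

Lemma boundary_finite P (Z : seq M) p :
  (forall a b, a <= b -> avoids Z a b -> (P a <-> P b)) -> boundary P p -> p \in Z.
Proof.
move=> HZ bp; apply: contrapT => /negP pZ.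
have [|c [_ cp cZ]] := @finite_gap_left _ Z (p - 1) p; first by lra.
have [|d [pd _ dZ]] := @finite_gap_right _ Z p (p + 1); first by lra.
have av : avoids Z c d.
  move=> z zZ; apply/negP => /andP[z1 z2]; have [zp|pz|zp] := ltgtP z p.
  - by have := cZ _ zZ zp; lra.
  - by have := dZ _ zZ pz; lra.
  - by move: pZ; rewrite -zp zZ.
have Pcd y : `|y - p| < Num.min (p - c) (d - p) -> (P y <-> P c).
  rewrite lt_min !ltr_norml => /andP[/andP[? ?] /andP[? ?]].
  apply: iff_sym; apply: HZ; first by lra.
  by apply: avoids_sub av; lra.
have [|[y [/Pcd yp Py]] [z [/Pcd zp Pz]]] := bp (Num.min (p - c) (d - p)).
  by rewrite lt_min !subr_gt0 cp.
by apply: Pz; apply/zp/yp.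
Qed.

Lemma boundary_const P a b : definable1 P -> a <= b ->
  (forall x, a <= x <= b -> ~ boundary P x) -> P a <-> P b.
Proof.
move=> dP ab nb.
have H (Q : M -> Prop) : definable1 Q ->
    (forall x, a <= x <= b -> ~ boundary Q x) -> Q a -> Q b.
  move=> dQ nbQ Qa; apply: (def1_connected dQ ab) => // x xab.
  apply: contrapT => nr; apply: (nbQ x xab) => r r0.
  split; apply: contrapT => H; apply: nr; exists r => // y yab yx.
    split=> [Qy|Qx]; first by case: H; exists y.
    by case: H; exists x; rewrite subrr normr0.
  split=> [Qy|Qx]; last by apply: contrapT => nQ; apply: H; exists y.
  by apply: contrapT => nQ; apply: H; exists x; rewrite subrr normr0.
split; first exact: H.
move=> Pb; apply: contrapT => nPa; have := H (fun x => ~ P x); apply=> //.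
  exact: def_not.
move=> x xab bx; apply: (nb x xab) => r /bx [[y [y1 y2]] [z [z1 z2]]].
by split; [exists z; split=> //; apply: contrapT|exists y].
Qed.

(* A nonempty definable set contains its boundary point, or [0], or a point at
   distance [1] of its boundary, or the midpoint of two boundary points. *)
Lemma def_choice A : definable A ->
  exists s : seq M -> M, definable_fun s /\ forall e, (exists y, A (y :: e)) -> A (s e :: e).
Proof.
move=> dA; pose bd e p := boundary (fun y => A (y :: e)) p.
pose cand e y := A (y :: e) /\ (y = 0 \/ bd e y \/
  (exists p, bd e p /\ (y = p + 1 \/ y = p - 1)) \/
  exists p q, bd e p /\ bd e q /\ y = (p + q) * 2^-1).
have [N HN] := def_finite dA.
have candfin e : exists W : seq M, forall y, cand e y -> y \in W.
  have [Z [_ HZ]] := HN e; have bdZ p : bd e p -> p \in Z by apply: boundary_finite.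
  exists (0 :: Z ++ [seq p + 1 | p <- Z] ++ [seq p - 1 | p <- Z] ++
          [seq (p + q) * 2^-1 | p <- Z, q <- Z]).
  move=> y [_]; rewrite inE !mem_cat.
  case=> [->|[/bdZ ->|[[p [/bdZ pZ [->|->]]]|[p [q [/bdZ pZ [/bdZ qZ ->]]]]]]].
  - by rewrite eqxx.
  - by rewrite orbT.
  - by rewrite (map_f (fun p => p + 1)) // !orbT.
  - by rewrite (map_f (fun p => p - 1)) // !orbT.
  - by rewrite (allpairs_f (fun p q => (p + q) * 2^-1)) // !orbT.
have candex e : (exists y, A (y :: e)) -> exists y, cand e y.
  move=> [y Ay]; have [by_|nby] := pselect (bd e y).
    by exists y; split=> //; right; left.
  have [Z [_ HZ]] := HN e; have bdZ p : bd e p -> p \in Z by apply: boundary_finite.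
  (* If no boundary point separates [w] from [y], then [w] belongs to the section of [A] together
     with [y]. *)
  have move_to w : (forall z, bd e z -> z < y -> z < w) ->
      (forall z, bd e z -> y < z -> w < z) -> A (w :: e).
    move=> H1 H2; have dAe := def1P e dA.
    have nb x : y <= x <= w \/ w <= x <= y -> ~ bd e x.
      move=> xx bx; have [xy|yx|yx] := ltgtP x y; last by rewrite yx in bx.
        by have := H1 _ bx xy; lra.
      by have := H2 _ bx yx; lra.
    have [yw|/ltW wy] := leP y w.
      by apply/(boundary_const dAe yw) => // x xx; apply: nb; left.
    by apply/(boundary_const dAe wy) => // x xx; apply: nb; right.
  have maxP : (exists2 p, bd e p & p < y) ->
      exists p, [/\ bd e p, p < y & forall z, bd e z -> z < y -> z <= p].
    move=> [p bp py]; have [|q [_ [bq qy] qmax]] := @finite_max Z (fun p => bd e p /\ p < y).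
      by exists p => //; apply: bdZ.
    by exists q; split=> // z bz zy; apply: qmax => //; apply: bdZ.
  have minP : (exists2 p, bd e p & y < p) ->
      exists p, [/\ bd e p, y < p & forall z, bd e z -> y < z -> p <= z].
    move=> [p bp py]; have [|q [_ [bq qy] qmax]] := @finite_min Z (fun p => bd e p /\ y < p).
      by exists p => //; apply: bdZ.
    by exists q; split=> // z bz zy; apply: qmax => //; apply: bdZ.
  have [/maxP [p [bp py pmax]]|nolow] := pselect (exists2 p, bd e p & p < y).
    have [/minP [q [bq yq qmin]]|nohigh] := pselect (exists2 p, bd e p & y < p).
      exists ((p + q) / 2); split; last by do 3 right; exists p, q.
      apply: move_to => z bz zy; first by have := pmax _ bz zy; lra.
      by have := qmin _ bz zy; lra.
    exists (p + 1); split; last by do 2 right; left; exists p; split=> //; left.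
    apply: move_to => z bz zy; first by have := pmax _ bz zy; lra.
    by case: nohigh; exists z.
  have [/minP [q [bq yq qmin]]|nohigh] := pselect (exists2 p, bd e p & y < p).
    exists (q - 1); split; last by do 2 right; left; exists q; split=> //; right.
    apply: move_to => z bz zy; last by have := qmin _ bz zy; lra.
    by case: nolow; exists z.
  exists 0; split; last by left.
  by apply: move_to => z bz zy; [case: nolow|case: nohigh]; exists z.
(* There are finitely many candidates; taking the least one makes the choice unique, hence
   definable. The value is 0 over an empty section. *)
pose G e y := (cand e y /\ forall z, cand e z -> y <= z) \/
              ((~ exists z, cand e z) /\ y = 0).
have Gex e : exists y, G e y.
  have [[y cy]|nc] := pselect (exists z, cand e z); last by exists 0; right.
  have [W HW] := candfin e.
  have [|p [_ cp pmin]] := @finite_min W (cand e); first by exists y => //; apply: HW.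
  by exists p; left; split=> // z cz; apply: pmin => //; apply: HW.
have Guniq e y z : G e y -> G e z -> y = z.
  move=> [[cy ymin]|[nc ->]] [[cz zmin]|[nc' ->]] //.
  - by apply/eqP; rewrite eq_le ymin //= zmin.
  - by case: nc'; exists y.
  - by case: nc; exists z.
have [s Hs] := choice Gex; exists s; split; last first.
  by move=> e /candex ex; case: (Hs e) => [[[]]|[]].
have dG : definable (fun e => G (behead e) e`_0).
  rewrite /G /cand /bd /boundary; def_tac;
    by apply: (def_sub dA); apply: dsub_consn; dsub_tac.
apply: (def_iff _ dG) => e; split=> [/Guniq|->]; last exact: Hs.
by apply; exact: Hs.
Qed.

End Continuity.

(** * Tropicalizations of definable paths *)

Section AbsVal.

Variables (R : realType) (M : rcfType) (w : M -> R).
Hypothesis wP : compatible_nonarch_absval w.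
Hypothesis w_surj : forall r : R, 0 <= r -> exists x, w x = r.
Implicit Types (a b c x y z : M).

Lemma w_ge0 x : 0 <= w x. Proof. exact: absval_ge0 wP x. Qed.

Lemma w0 : w 0 = 0. Proof. exact/(absval_eq0 wP). Qed.

Lemma wM x y : w (x * y) = w x * w y. Proof. exact: absvalM wP x y. Qed.

Lemma w_gt0 x : x != 0 -> 0 < w x.
Proof.
move=> x0; rewrite lt_neqAle w_ge0 andbT eq_sym.
by apply: contra x0 => /eqP /(absval_eq0 wP) ->.
Qed.

Lemma w1 : w 1 = 1.
Proof.
have := wM 1 1; rewrite mulr1 => /esym /eqP; rewrite -subr_eq0 -{3}[w 1]mulr1 -mulrBr.
by rewrite mulf_eq0 gt_eqF ?w_gt0 ?oner_neq0 //= subr_eq0 => /eqP.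
Qed.

Lemma wN x : w (- x) = w x.
Proof.
rewrite -mulN1r wM; suff -> : w (-1) = 1 by rewrite mul1r.
apply/eqP; rewrite -(@eqrXn2 _ 2) ?w_ge0 ?ler01 // expr1n expr2 -wM mulrNN mulr1.
by rewrite w1.
Qed.

Lemma w_mono x y : 0 <= x -> x <= y -> w x <= w y.
Proof. exact: absval_compatible wP x y. Qed.

Lemma w_lt x y : 0 <= y -> w x < w y -> x < y.
Proof. by move=> y0; rewrite !ltNge; apply: contra; exact: w_mono. Qed.

Lemma w2 : w 2 = 1.
Proof.
apply/eqP; rewrite eq_le; apply/andP; split.
  by apply: le_trans (absval_ultra wP 1 1) _; rewrite maxxx w1.
by rewrite -w1 w_mono // ler1n.
Qed.

Lemma w_surj_pos r : 0 < r -> exists2 x, 0 < x & w x = r.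
Proof.
move=> r0; have [x xr] := w_surj (ltW r0); exists `|x|.
  by rewrite normr_gt0; apply: contraTN r0 => /eqP x0; rewrite -xr x0 w0 ltxx.
by case: ger0P => _; rewrite ?wN.
Qed.

(** Since [w 2 = 1], changing a positive element by a factor of at most 2 does not affect [w]. So
    [w] is locally constant away from 0 for the order topology. *)
Lemma w_near x y : 0 < x -> `|y - x| < x / 2 -> 0 < y /\ w y = w x.
Proof.
move=> x0; rewrite ltr_norml => /andP[h1 h2]; have y0 : 0 < y by lra.
split=> //; apply/eqP; rewrite eq_le; apply/andP; split.
  by rewrite -[w x]mul1r -w2 -wM w_mono //; lra.
by rewrite -[w y]mul1r -w2 -wM w_mono //; lra.
Qed.

Lemma finite_ball k (P : nat -> M -> Prop) x :
  (forall i, (i < k)%N -> exists2 r, 0 < r & forall y, `|y - x| < r -> P i y) ->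
  exists2 r, 0 < r & forall y, `|y - x| < r -> forall i, (i < k)%N -> P i y.
Proof.
elim: k => [|k IH] H; first by exists 1.
have [|r r0 Hr] := IH; first by move=> i ik; apply: H; apply: ltnW.
have [s s0 Hs] := H k (leqnn _).
exists (Num.min r s); first by rewrite lt_min r0.
move=> y; rewrite lt_min => /andP[yr ys] i; rewrite ltnS leq_eqVlt.
by move=> /orP[/eqP->|ik]; [apply: Hs|apply: Hr].
Qed.

Lemma positive_path_connected k (G : nat -> M -> M) (f : M -> bool) a b :
  a <= b -> (forall i, (i < k)%N -> definable_fun1 (G i)) ->
  (forall i x, (i < k)%N -> a <= x <= b -> continuous_at (G i) x /\ 0 < G i x) ->
  (forall x, a <= x <= b -> exists2 d : R, 0 < d & forall y, a <= y <= b ->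
     (forall i, (i < k)%N -> `|w (G i y) - w (G i x)| < d) -> f y = f x) ->
  f a = f b.
Proof.
move=> ab dG Gcont floc; apply: contrapT => fab.
have dGg i g j : (i < k)%N -> definable_subst g -> definable_fun (fun e => G i (g e)`_j).
  by move=> ik dg; apply: (dfun_sub (g := fun e => (g e)`_j :: e) (dG i ik));
     apply: dsub_consn => //; dsub_tac.
have ftop x : a <= x <= b ->
    exists2 r, 0 < r & forall y, a <= y <= b -> `|y - x| < r -> f y = f x.
  move=> xab; have [d d0 Hd] := floc x xab.
  have [r r0 Hr] : exists2 r, 0 < r & forall y, `|y - x| < r -> forall i, (i < k)%N ->
      `|w (G i y) - w (G i x)| < d.
    apply: finite_ball => i ik; have [ci G0] := Gcont i x ik xab.
    have [|r [r0 Hr]] := ci (G i x / 2); first by rewrite divr_gt0.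
    exists r => // y /Hr /(w_near G0) [_ ->].
    by rewrite subrr normr0.
  by exists r => // y yab yx; apply: Hd => //; apply: Hr.
have Gbnd i : (i < k)%N -> exists2 c, 0 < c &
    forall x, a <= x <= b -> c <= G i x /\ G i x * c <= 1.
  move=> ik.
  (* In place of compactness, [def1_connected] is applied to the existence of bounds for [G i] and
     its inverse on [[a, x]]. *)
  pose P x := exists c, 0 < c /\ forall y, (a <= y /\ y <= x) ->
    c <= G i y /\ G i y * c <= 1.
  have dP : definable1 P by rewrite /definable1 /P; def_tac; apply: dGg => //; dsub_tac.
  have near x : a <= x <= b -> exists2 r, 0 < r & exists2 c, 0 < c &
      forall y, `|y - x| < r -> c <= G i y /\ G i y * c <= 1.
    move=> xab; have [ci G0] := Gcont i x ik xab.
    have G2 : 0 < G i x / 2 by rewrite divr_gt0.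
    have G3 : 0 < (2 * G i x)^-1 by rewrite invr_gt0 mulr_gt0.
    have [r [r0 Hr]] := ci _ G2; exists r => //.
    exists (Num.min (G i x / 2) (2 * G i x)^-1); first by rewrite lt_min G2 G3.
    move=> y /Hr; rewrite ltr_norml => /andP[h1 h2]; split.
      by rewrite ge_min; apply/orP; left; lra.
    apply: (@le_trans _ _ (G i y * (2 * G i x)^-1)).
      by rewrite ler_wpM2l ?ge_min ?lexx ?orbT //; lra.
    by rewrite ler_pdivrMr ?mulr_gt0 // mul1r; lra.
  have Pmono x y : y <= x -> P x -> P y.
    move=> yx [c [c0 Hc]]; exists c; split=> // z [z1 z2]; apply: Hc.
    by rewrite z1 (le_trans z2).
  have [c [c0 Hc]] : P b.
    apply: (def1_connected dP ab) => [x xab|].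
      have [r r0 [c c0 Hc]] := near x xab; exists r => // y yab yx.
      have up u v : `|u - x| < r -> `|v - x| < r -> P u -> P v.
        move=> ux vx [c' [c'0 Hc']]; exists (Num.min c c').
        rewrite lt_min c0; split=> // z [z1 z2].
        have le1 : Num.min c c' <= c by rewrite ge_min lexx.
        have le2 : Num.min c c' <= c' by rewrite ge_min lexx orbT.
        have [zu|uz] := leP z u.
          have [h1 h2] := Hc' z (conj z1 zu); split; first exact: le_trans h1.
          apply: le_trans h2; rewrite ler_wpM2l //.
          by apply: le_trans h1; apply: ltW.
        have zx : `|z - x| < r.
          by move: ux vx; rewrite !ltr_norml => /andP[? ?] /andP[? ?]; lra.
        have [h1 h2] := Hc z zx; split; first exact: le_trans h1.
        apply: le_trans h2; rewrite ler_wpM2l //.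
        by apply: le_trans h1; apply: ltW.
      have xx : `|x - x| < r by rewrite subrr normr0.
      by split; apply: up.
    have aab : a <= a <= b by rewrite lexx.
    have [r r0 [c c0 Hc]] := near a aab; exists c; split=> // y [y1 y2].
    have -> : y = a by apply/eqP; rewrite eq_le y1 y2.
    by apply: Hc; rewrite subrr normr0.
  by exists c => // x /andP[x1 x2]; apply: Hc.
(* [L] contains everything below [a], vacuously, and nothing above [b]; this makes it a lower part
   of all of [M], as [def1_gap] expects. *)
pose L x := forall z, a <= z <= x -> z <= b /\ f z = f a.
have Ldown x y : x <= y -> L y -> L x.
  by move=> xy Ly z /andP[z1 z2]; apply: Ly; rewrite z1 (le_trans z2).
have La : L a.
  by move=> z /andP[z1 z2]; have -> : z = a by apply/eqP; rewrite eq_le z1 z2.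
have nLb : ~ L b by move=> /(_ b) []; rewrite ?ab ?lexx // => _ /esym /fab.
have Lab x : L x -> a <= x -> x <= b /\ f x = f a.
  by move=> Lx ax; apply: Lx; rewrite ax lexx.
have nLa x : ~ L x -> a < x by move=> nLx; rewrite ltNge; apply/negP => /Ldown /(_ La).
have LnL x y : L x -> ~ L y -> x < y by move=> Lx nLy; rewrite ltNge; apply/negP => /Ldown /(_ Lx).
have noMax x : L x -> exists2 y, L y & x < y.
  move=> Lx; have [xa|ax] := ltP x a; first by exists a.
  have [xb fx] := Lab _ Lx ax; have xltb := LnL _ _ Lx nLb.
  have [|r r0 Hr] := ftop x; first by rewrite ax.
  exists (Num.min b (x + r / 2)); last by rewrite lt_min xltb; lra.
  move=> z /andP[z1]; rewrite le_min => /andP[z2 z3]; split=> //.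
  have [zx|xz] := leP z x; first by have [] := Lx z; rewrite ?z1.
  rewrite -fx; apply: Hr; first by rewrite z1.
  by rewrite gtr0_norm; lra.
have noMin x : ~ L x -> exists2 y, ~ L y & y < x.
  move=> nLx; have [bx|xb] := ltP b x; first by exists b.
  have ax := nLa _ nLx.
  have [z /andP[z1 z2] fz] : exists2 z, a <= z <= x & f z <> f a.
    apply: contrapT => H; apply: nLx => z /andP[z1 z2]; split; first exact: le_trans xb.
    by apply: contrapT => fz; apply: H; exists z; rewrite ?z1.
  have az : a < z.
    by rewrite lt_neqAle z1 andbT; apply/eqP => az; apply: fz; rewrite -az.
  have [|r r0 Hr] := ftop z; first by rewrite z1 (le_trans z2).
  exists (Num.max a (z - r / 2)); last by apply: lt_le_trans z2; rewrite gt_max az; lra.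
  have m1 : Num.max a (z - r / 2) < z by rewrite gt_max az; lra.
  have m2 : a <= Num.max a (z - r / 2) by rewrite le_max lexx.
  have m3 : z - r / 2 <= Num.max a (z - r / 2) by rewrite le_max lexx orbT.
  move=> /Lab [] // mb qf_formula; apply: fz; rewrite -qf_formula; apply/esym/Hr; first by rewrite m2.
  by rewrite ltr0_norm; lra.
have gap P : definable1 P -> exists l u, [/\ L l, ~ L u &
    forall x y, l <= x <= u -> l <= y <= u -> (P x <-> P y)].
  by move=> dP; apply: def1_gap dP Ldown _ _ noMax noMin; [exists a|exists b].
(* Neighbourhoods of the gap reach into both sides, so a property that holds [near] it holds at
   points with both values of [f]; this is [near_ex]. *)
pose near (P : M -> Prop) := exists l u, [/\ L l, ~ L u & forall x, l <= x <= u -> P x].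
have near_em P : definable1 P -> near P \/ near (fun x => ~ P x).
  move=> /gap [l [u [Ll nLu H]]]; have lu := LnL _ _ Ll nLu.
  have lul : l <= l <= u by rewrite lexx ltW.
  have [Pl|nPl] := pselect (P l); [left|right]; exists l, u; split=> // x xlu.
    by apply/(H x l).
  by move/(H x l xlu lul).
have near_and (P Q : M -> Prop) : near P -> near Q -> near (fun x => P x /\ Q x).
  move=> [l [u [Ll nLu H]]] [l' [u' [Ll' nLu' H']]].
  exists (Num.max l l'), (Num.min u u'); split; [by case: leP|by case: leP|].
  move=> x; rewrite ge_max le_min => /andP[/andP[? ?] /andP[? ?]].
  by split; [apply: H|apply: H']; apply/andP.
have near_imp (P Q : M -> Prop) : (forall x, a <= x <= b -> P x -> Q x) -> near P ->
    near (fun x => a <= x <= b -> Q x).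
  move=> PQ [l [u [Ll nLu H]]]; exists l, u; split=> // x xlu xab.
  by apply: PQ => //; apply: H.
have near_all (P : nat -> M -> Prop) j : (forall i, (i < j)%N -> near (P i)) ->
    near (fun x => forall i, (i < j)%N -> P i x).
  elim: j => [|j IH] H; first by exists a, b.
  have [|l [u [Ll nLu Hl]]] := near_and _ _ (IH _) (H j (leqnn _)).
    by move=> i ij; apply: H; apply: ltnW.
  exists l, u; split=> // x /Hl [h1 h2] i; rewrite ltnS leq_eqVlt.
  by move=> /orP[/eqP->|]; [|apply: h1].
have near_ex P : near (fun x => a <= x <= b -> P x) ->
    exists x y, [/\ a <= x <= b, a <= y <= b, P x, P y & f x = f a /\ f y <> f a].
  move=> [l [u [Ll nLu H]]]; have lu := LnL _ _ Ll nLu; have au := nLa _ nLu.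
  have xlu : l <= Num.max l a <= u by rewrite le_max lexx ge_max (ltW lu) (ltW au).
  have Lx : L (Num.max l a) by case: leP.
  have ax : a <= Num.max l a by rewrite le_max lexx orbT.
  have [xb fx] := Lab _ Lx ax.
  have [z [z1 z2 zb fz]] : exists z, [/\ a <= z, z <= u, z <= b & f z <> f a].
    have [ub|bu] := leP u b; last by exists b; split=> //; [exact: ltW|exact/nesym].
    apply: contrapT => H'; apply: nLu => z /andP[z1 z2].
    split; first exact: le_trans ub.
    by apply: contrapT => fz; apply: H'; exists z; split=> //; apply: le_trans ub.
  have nLz : ~ L z by move=> /Lab [].
  have lz := ltW (LnL _ _ Ll nLz).
  exists (Num.max l a), z; split=> //; [by rewrite ax|by rewrite z1| |].
    by apply: H => //; rewrite ax.
  by apply: H; rewrite ?lz ?z1.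
have lim i : (i < k)%N -> exists2 p : R, 0 < p &
    forall d, 0 < d -> near (fun x => a <= x <= b -> `|w (G i x) - p| < d).
  move=> ik; have [c c0 Hc] := Gbnd i ik.
  have dlt t : definable1 (fun x => t < G i x).
    by rewrite /definable1; def_tac; exact: (dG i ik).
  (* The limit of [w (G i)] is the supremum of the values [w t] over the positive [t] that [G i]
     exceeds near the gap. If [w t'] is larger than it, then [t'] is no such element, and [near_em]
     yields [G i <= t'] near the gap. The lower bound [c] keeps the limit positive. *)
  pose E : set R := [set r | exists t, [/\ 0 < t, w t = r & near (fun x => a <= x <= b -> t < G i x)]].
  have nE : E (w (c / 2)).
    exists (c / 2); split=> //; first exact: divr_gt0.
    exists a, b; split=> // x _ xab; have [h _] := Hc x xab.
    by lra.
  have bE : ubound E (w c^-1).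
    move=> r [t [t0 <- /near_ex [x [_ [xab _ tx _ _]]]]]; apply: w_mono; first exact: ltW.
    have [_ h] := Hc x xab; apply: (le_trans (ltW tx)).
    by rewrite -[c^-1]mul1r ler_pdivlMr.
  have supE : has_sup E by split; [exists (w (c / 2))|exists (w c^-1)].
  have p0 : 0 < sup E.
    apply: (@lt_le_trans _ _ (w (c / 2))); first by rewrite w_gt0 // gt_eqF // divr_gt0.
    by apply: ub_le_sup => //; exists (w c^-1).
  exists (sup E) => // d d0.
  have [_ [t [t0 <- nt]] tp] := sup_adherent d0 supE.
  have [|t' t'0 wt'] := @w_surj_pos (sup E + d / 2); first by rewrite addr_gt0 ?divr_gt0.
  have [nt'|nt'] := near_em _ (dlt t').
    have : sup E + d / 2 <= sup E.
      apply: ub_le_sup; first by exists (w c^-1).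
      by exists t'; split=> //; apply: near_imp nt'.
    by lra.
  have := near_and _ _ nt nt'; apply: near_imp => x xab [h1 /negP h2].
  rewrite -leNgt in h2; have := w_mono (ltW t0) (ltW (h1 xab)).
  have [_ Gx0] := Gcont i x ik xab.
  have := w_mono (ltW Gx0) h2; rewrite wt' => ? ?.
  by rewrite ltr_norml; apply/andP; split; lra.
have [p pP] : exists p : nat -> R, forall i, (i < k)%N -> 0 < p i /\
    forall d, 0 < d -> near (fun x => a <= x <= b -> `|w (G i x) - p i| < d).
  have H i : exists p : R, (i < k)%N -> 0 < p /\
      forall d, 0 < d -> near (fun x => a <= x <= b -> `|w (G i x) - p| < d).
    have [ik|_] := boolP (i < k)%N; last by exists 0.
    by have [p p0 Hp] := lim i ik; exists p.
  by have [p Hp] := choice H; exists p.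
have [q qP] : exists q : nat -> M, forall i, (i < k)%N -> 0 < q i /\ w (q i) = p i.
  have H i : exists q, (i < k)%N -> 0 < q /\ w q = p i.
    have [ik|_] := boolP (i < k)%N; last by exists 0.
    by have [x x0 xp] := w_surj_pos (pP i ik).1; exists x.
  by have [q Hq] := choice H; exists q.
(* The limit point [p] lies in the tropicalization of the path: the infimum of
   the definable set of the [t >= 1] such that the path meets the box of the
   [y] with [q i / t <= y i <= t * q i] has absolute value 1. *)
have [y yab wy] : exists2 y, a <= y <= b & forall i, (i < k)%N -> w (G i y) = p i.
  pose D t := 1 <= t /\ exists y, (a <= y /\ y <= b) /\ forall i, (i < k)%N ->
    q i <= t * G i y /\ G i y <= t * q i.
  have dD : definable1 (fun t => D (- t)).
    rewrite /definable1 /D; def_tac; by apply: dGg => //; dsub_tac.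
  have Dbig t : 0 < t -> 1 < w t -> D t.
    move=> t0 wt; split; first by apply/ltW/w_lt; rewrite ?w1 // ltW.
    have [x [_ [xab _ Hx _ _]]] : exists x y, [/\ a <= x <= b, a <= y <= b,
       (forall i, (i < k)%N -> q i <= t * G i x /\ G i x <= t * q i),
       (forall i, (i < k)%N -> q i <= t * G i y /\ G i y <= t * q i)
       & f x = f a /\ f y <> f a].
      apply: near_ex.
      have: near (fun x => forall i, (i < k)%N -> a <= x <= b ->
          q i <= t * G i x /\ G i x <= t * q i).
        apply: near_all => i ik; have [p0 Hp] := pP i ik; have [q0 wq] := qP i ik.
        (* With this [d], the lower end [p i - d] is [p i / w t], and the upper end [p i + d] is at
           most [p i * w t] because [w t + 1 / w t >= 2]. *)
        have d0 : 0 < p i * (1 - (w t)^-1).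
          by rewrite mulr_gt0 // subr_gt0 invf_lt1 // (lt_trans ltr01).
        have := Hp _ d0; apply: near_imp => x xab /(_ xab).
        have [_ Gx0] := Gcont i x ik xab.
        rewrite ltr_norml => /andP[h1 h2]; split; apply/ltW/w_lt.
        - by rewrite ltW // mulr_gt0.
        - rewrite wM wq mulrC -ltr_pdivrMr; last exact: lt_trans wt.
          by lra.
        - by rewrite ltW // mulr_gt0.
        rewrite wM wq; apply: (@lt_le_trans _ _ (p i + p i * (1 - (w t)^-1))); first by lra.
        have -> : p i + p i * (1 - (w t)^-1) = p i * (2 - (w t)^-1) by ring.
        rewrite mulrC ler_wpM2r //; first exact: ltW.
        have wt0 : 0 < w t by apply: lt_trans wt.
        have e : w t * (w t)^-1 = 1 by rewrite divff // gt_eqF.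
        have : 0 <= (w t - 1) ^+ 2 * (w t)^-1.
          by rewrite mulr_ge0 ?sqr_ge0 // invr_ge0 ltW.
        have -> : (w t - 1) ^+ 2 * (w t)^-1 =
          w t * (w t * (w t)^-1) - 2 * (w t * (w t)^-1) + (w t)^-1 by ring.
        by rewrite e; lra.
      by apply: near_imp => x xab H i ik; apply: H.
    by exists x; split=> //; apply/andP.
  have [|t0 t0_gt0 wt0] := @w_surj_pos 2; first by [].
  have [||s [s1 s2]] := def1_sup dD.
  - by exists (- t0); rewrite opprK; apply: Dbig => //; rewrite wt0 ltr1n.
  - by exists (- 1) => x [h _]; rewrite lerNr.
  have s_le : s <= - 1.
    rewrite leNgt; apply/negP => /s2 [x [h _]]; rewrite ltrNl => ?.
    by move: h; rewrite leNgt => /negP.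
  (* The infimum of [D] is [- s], as [def1_sup] is applied to the opposite of [D]. If [w (- s)]
     exceeded 1, some [t] with value strictly between 1 and [w (- s)] would lie in [D] below the
     infimum. *)
  have ws : w (- s) <= 1.
    rewrite leNgt; apply/negP => ws.
    have [r /andP[r1 r2]] : exists r : R, 1 < r < w (- s).
      by exists ((1 + w (- s)) / 2); apply/andP; split; lra.
    have [|t t_gt0 wt] := @w_surj_pos r; first exact: lt_trans r1.
    have /s1 ts : D (- - t) by rewrite opprK; apply: Dbig; rewrite ?wt.
    have ns : 0 <= - s by lra.
    have := w_lt ns (x := t); rewrite wt => /(_ r2); lra.
  (* The infimum may not belong to [D], but an element of [D] below its double does just as well, as
     [w 2 = 1]. Its absolute value is 1, so the corresponding [y] satisfies [w (G i y) = w (q i)]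
     exactly. *)
  have [x [x1 [y [/andP yab Hy]]] sx] : exists2 x, D (- x) & 2 * s < x.
    by apply: s2; lra.
  have wx : w (- x) = 1.
    apply/eqP; rewrite eq_le -{2}w1 w_mono // andbT.
    apply: (@le_trans _ _ (w (2 * - s))); first by rewrite w_mono //; lra.
    by rewrite wM w2 mul1r.
  exists y => // i ik; have [h1 h2] := Hy i ik; have [q0 <-] := qP i ik.
  have [_ Gy0] := Gcont i y ik yab.
  apply/eqP; rewrite eq_le; apply/andP; split.
    by rewrite -[w (q i)]mul1r -wx -wM w_mono // ltW.
  by rewrite -[w (G i y)]mul1r -wx -wM w_mono // ltW.
have [d d0 Hd] := floc y yab.
have : near (fun x => forall i, (i < k)%N -> a <= x <= b -> `|w (G i x) - p i| < d).
  by apply: near_all => i ik; apply: (pP i ik).2.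
move=> /(near_imp _ (fun x => f x = f y)) [|l [u [Ll nLu H]]].
  by move=> x xab H; apply: Hd => // i ik; rewrite wy //; apply: H.
have [|x [z [_ _ fx fz [fxa fza]]]] := near_ex (fun x => f x = f y).
  by exists l, u.
by apply: fza; rewrite fz -fx.
Qed.

End AbsVal.

(** * Definability by induction on the dimension *)

Section TropInduction.

Variables (R : realType) (M : rcfType) (w : M -> R).
Hypothesis wP : compatible_nonarch_absval w.
Hypothesis w_surj : forall r : R, 0 <= r -> exists x, w x = r.
Implicit Types (a b c x y z : M) (e : seq M).

Definition signed_abs x : R := (sgz x)%:~R * w x.

Lemma sabs0 : signed_abs 0 = 0. Proof. by rewrite /signed_abs sgz0 mul0r. Qed.

Lemma sabs_pos x : 0 < x -> signed_abs x = w x.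
Proof. by move=> x0; rewrite /signed_abs gtr0_sgz // mul1r. Qed.

Lemma sabsN x : signed_abs (- x) = - signed_abs x.
Proof. by rewrite /signed_abs sgzN mulrNz mulNr (wN wP). Qed.

(** On the path each [F i] is either identically zero or of constant sign, by continuity and
    [def1_connected]. The positive case applies to [G i], which is [F i] or its opposite, or the
    constant 1 when [F i] vanishes; this loses no information on the tropicalizations. *)
Lemma path_connected k (F : nat -> M -> M) (f : M -> bool) a b :
  a <= b -> (forall i, (i < k)%N -> definable_fun1 (F i)) ->
  (forall i x, (i < k)%N -> a <= x <= b -> continuous_at (F i) x) ->
  (forall i, (i < k)%N -> (forall x, a <= x <= b -> F i x = 0) \/
                          (forall x, a <= x <= b -> F i x != 0)) ->
  (forall x, a <= x <= b -> exists2 d : R, 0 < d & forall y, a <= y <= b ->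
     (forall i, (i < k)%N -> `|signed_abs (F i y) - signed_abs (F i x)| < d) -> f y = f x) ->
  f a = f b.
Proof.
move=> ab dF Fcont F0 floc.
pose G i : M -> M := if F i a == 0 then fun=> 1 else
  if 0 < F i a then F i else fun x => - F i x.
have aab : a <= a <= b by rewrite lexx.
have posP (H : M -> M) : definable_fun1 H -> (forall x, a <= x <= b -> continuous_at H x) ->
    (forall x, a <= x <= b -> H x != 0) -> 0 < H a -> forall x, a <= x <= b -> 0 < H x.
  move=> dH cH nH Ha x /andP[ax xb].
  apply: (@def1_connected _ (fun x => 0 < H x) a x) => //.
    by rewrite /definable1; def_tac.
  move=> y /andP[ay yx]; have yab : a <= y <= b by rewrite ay (le_trans yx).
  have [|r [r0 Hr]] := cH y yab `|H y|; first by rewrite normr_gt0 nH.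
  exists r => // z _ /Hr; rewrite ltr_norml.
  have := nH _ yab; have [Hy|Hy|->] := ltrgt0P (H y); last by move=> /eqP.
    by move=> _ /andP[h _]; split=> _; lra.
  by move=> _ /andP[_ h]; split=> ?; lra.
have contN (H : M -> M) x : continuous_at H x -> continuous_at (fun x => - H x) x.
  move=> cH r r0; have [d [d0 Hd]] := cH r r0; exists d; split=> // y /Hd.
  by rewrite -opprD normrN.
have GP i : (i < k)%N -> [/\ definable_fun1 (G i),
    (forall x, a <= x <= b -> continuous_at (G i) x /\ 0 < G i x) &
    forall x y, a <= x <= b -> a <= y <= b ->
     `|signed_abs (F i y) - signed_abs (F i x)| <= `|w (G i y) - w (G i x)|].
  move=> ik; have dFi := dF i ik; have cFi x := Fcont i x ik.
  rewrite /G; case: ifPn => [/eqP Fa|Fa].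
    split; first exact: dfun_const.
      move=> x _; split=> // r r0; exists 1; split=> // y _.
      by rewrite subrr normr0.
    move=> x y xab yab; rewrite subrr normr0.
    have [H|/(_ a aab)] := F0 i ik; last by rewrite Fa eqxx.
    by rewrite !H // subrr normr0.
  have nF x : a <= x <= b -> F i x != 0.
    by have [/(_ a aab) H|] := F0 i ik; [move: Fa; rewrite H eqxx|apply].
  case: ifPn => [Fa0|]; last rewrite -leNgt le_eqVlt (negPf Fa) /= => Fa0.
    have pF := posP _ dFi cFi nF Fa0; split=> //.
      by move=> x xab; split; [exact: cFi|exact: pF].
    by move=> x y xab yab; rewrite !sabs_pos ?pF.
  have dN : definable_fun1 (fun x => - F i x) by rewrite /definable_fun1; dfun_tac.
  have pF : forall x, a <= x <= b -> 0 < - F i x.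
    apply: posP => //; last by rewrite oppr_gt0.
      by move=> x xab; apply/contN/cFi.
    by move=> x xab; rewrite oppr_eq0 nF.
  split=> // [x xab|x y xab yab]; first by split; [exact/contN/cFi|exact: pF].
  have E z : a <= z <= b -> signed_abs (F i z) = - w (- F i z).
    by move=> /pF Fz; rewrite -(sabs_pos Fz) sabsN opprK.
  by rewrite !E // -opprD normrN.
apply: (@positive_path_connected _ _ _ wP w_surj k G f) => //.
- by move=> i /GP[].
- by move=> i x /GP[_ H _]; exact: H.
move=> x xab; have [d d0 Hd] := floc x xab; exists d => // y yab Hy.
apply: Hd => // i ik; have [_ _ H] := GP i ik.
by apply: le_lt_trans (Hy i ik); apply: H.
Qed.

Lemma common_continuous k (F : nat -> M -> M) a b :
  (forall i, (i < k)%N -> definable_fun1 (F i)) -> a < b ->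
  exists a' b', [/\ a <= a', a' < b', b' <= b &
    forall i x, (i < k)%N -> a' <= x <= b' -> continuous_at (F i) x].
Proof.
move=> + ab; elim: k => [|k IH] dF; first by exists a, b; rewrite !lexx.
have [|a1 [b1 [h1 h2 h3 H1]]] := IH; first by move=> i ik; apply/dF/ltnW.
have [a2 [b2 [g1 g2 g3 H2]]] := dfun1_continuous (dF k (leqnn _)) h2.
exists a2, b2; split=> //; [lra|lra|].
move=> i x; rewrite ltnS leq_eqVlt => /orP[/eqP->|ik] xab; first exact: H2.
by apply: H1 => //; lra.
Qed.

Lemma def_finite_all k (A : nat -> seq M -> Prop) :
  (forall i, (i < k)%N -> definable (A i)) -> exists N, forall e, exists Z : seq M,
  (size Z <= N)%N /\ forall i a b, (i < k)%N -> a <= b -> avoids Z a b ->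
    (A i (a :: e) <-> A i (b :: e)).
Proof.
elim: k => [|k IH] dA; first by exists 0%N => e; exists [::].
have [|N HN] := IH; first by move=> i ik; apply/dA/ltnW.
have [N' HN'] := def_finite (dA k (leqnn _)); exists (N + N')%N => e.
have [Z [sZ HZ]] := HN e; have [Z' [sZ' HZ']] := HN' e.
exists (Z ++ Z'); split; first by rewrite size_cat leq_add.
move=> i a b; rewrite ltnS leq_eqVlt => /orP[/eqP->|ik] ab /avoids_cat[av av'].
  exact: HZ'.
exact: HZ.
Qed.

(** The number [k] of functions is independent of the dimension [m]: eliminating a variable composes
    the functions with a choice function and lowers [m] only. *)
Definition trop_locally_constant m k (F : nat -> seq M -> M) (C : seq M -> Prop)
    (f : seq M -> bool) :=
  forall e, size e = m -> C e -> exists2 d : R, 0 < d & forall e', size e' = m -> C e' ->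
    (forall i, (i < k)%N -> `|signed_abs (F i e') - signed_abs (F i e)| < d) -> f e' = f e.

Section Step.

Variables (m k : nat) (F : nat -> seq M -> M) (C : seq M -> Prop) (f : seq M -> bool).
Hypothesis dF : forall i, (i < k)%N -> definable_fun (F i).
Hypothesis dC : definable C.
Hypothesis fF : trop_locally_constant m.+1 k F C f.

Definition regular_at e y :=
  C (y :: e) /\ forall i, (i < k)%N -> continuous_at (fun y => F i (y :: e)) y.

Definition regular_between e a b := a < b /\ (forall y, a <= y /\ y <= b -> regular_at e y) /\
  forall i, (i < k)%N -> (forall y, a <= y /\ y <= b -> F i (y :: e) = 0) \/
                         (forall y, a <= y /\ y <= b -> ~ F i (y :: e) = 0).

(** Equality accounts for exceptional points, which form pieces by themselves. The relation is used
    only through a labelling [kappa] whose fibres consist of related points. *)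
Definition same_piece e a b := a = b \/ regular_between e a b \/ regular_between e b a.

Lemma regular_between_eq e a b : size e = m -> regular_between e a b -> f (a :: e) = f (b :: e).
Proof.
move=> se [ab [gab F0]].
apply: (@path_connected k (fun i y => F i (y :: e)) (fun y => f (y :: e)) a b (ltW ab)).
- by move=> i ik; apply/dfun1P/dF.
- by move=> i x ik /andP/gab [_]; apply.
- move=> i /F0 [] H; [left|right] => x /andP/H //.
  by move/eqP.
move=> x /andP/gab [Cx _]; have [|d d0 Hd] := fF _ Cx; first by rewrite /= se.
exists d => // y /andP/gab [Cy _]; apply: Hd => //.
by rewrite /= se.
Qed.

Lemma same_piece_eq e a b : size e = m -> same_piece e a b -> f (a :: e) = f (b :: e).
Proof.
move=> se [->//|[|]]; first exact: regular_between_eq.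
by move=> H; apply/esym/regular_between_eq.
Qed.

Lemma def_regular_at : definable (fun e => regular_at (behead e) e`_0).
Proof.
rewrite /regular_at; def_tac; first by apply: (def_sub dC); apply: dsub_consn; dsub_tac.
by apply/def_continuous_at/dF.
Qed.

Lemma def_regular_between : definable (fun e => regular_between (behead (behead e)) e`_0 e`_1).
Proof.
rewrite /regular_between; def_tac.
- exact: (def_sub (g := fun e => e`_0 :: (behead (behead (behead e)))) def_regular_at
    (dsub_consn 0 (dsub_id _) (dsub_behead (dsub_behead (dsub_behead (dsub_id _)))))).
- by apply: dfun_sub; [exact: dF|apply: dsub_consn; dsub_tac].
- by apply: dfun_sub; [exact: dF|apply: dsub_consn; dsub_tac].
Qed.

Lemma def_same_piece s : definable_fun s -> definable (fun e => same_piece (behead e) (s (behead e)) e`_0).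
Proof.
move=> ds; have ds' : definable_fun (fun e => s (behead e)).
  by apply: (dfun_sub ds); exact: (dsub_behead (dsub_id _)).
rewrite /same_piece; def_tac.
  exact: (def_cons (g := fun e => e`_0 :: behead e) ds' def_regular_between
    (dsub_consn 0 (dsub_id _) (dsub_behead (dsub_id _)))).
have dS : definable (fun e => regular_between (behead (behead e)) e`_1 e`_0).
  apply: (def_sub (g := fun e => e`_1 :: e`_0 :: behead (behead e)) def_regular_between).
  by apply: dsub_consn; [dsub_tac|apply: dsub_consn; dsub_tac].
exact: (def_cons (g := fun e => e`_0 :: behead e) ds' dS
    (dsub_consn 0 (dsub_id _) (dsub_behead (dsub_id _)))).
Qed.

Lemma count_between (Z : seq M) a b : a <= b ->
  count (fun z => (z < b)%R) Z =
  (count (fun z => (z < a)%R) Z + count (fun z => (a <= z)%R && (z < b)%R) Z)%N.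
Proof.
move=> ab; elim: Z => //= z Z ->.
by case: (ltP z a) => [za|az]; rewrite ?(lt_le_trans za ab) /=; lia.
Qed.

(** A uniform cell decomposition of the fibres: membership in [C], regularity and the vanishing of
    each [F i] are all definable, so between consecutive points of a finite set [Z] of bounded size
    they are constant. *)
Lemma same_piece_finite : exists N, forall e, exists kappa : M -> nat,
  (forall y, (kappa y < N)%N) /\
  forall y z, C (y :: e) -> C (z :: e) -> kappa y = kappa z -> same_piece e y z.
Proof.
pose A i := match i with 0 => C | 1 => fun e => regular_at (behead e) e`_0
            | i.+2 => fun e => F i e = 0 end.
have [|N HN] := @def_finite_all k.+2 A.
  move=> [|[|i]] ik //=; first exact: def_regular_at.
  by apply: def_eq; [exact: dF|exact: dfun_const].
exists (N + N).+1 => e; have [Z [sZ HZ]] := HN e.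
(* A point of [Z] is labelled by its index, any other point by the gap of [Z] containing it, shifted
   by [size Z]. All labels are at most [N + N]. *)
exists (fun y => if y \in Z then index y Z else size Z + count (fun z => (z < y)%R) Z)%N.
split=> [y|y z Cy Cz].
  case: ifP => [|_]; last by rewrite ltnS leq_add // (leq_trans (count_size _ _)).
  rewrite -index_mem => h; apply: (leq_trans h (leq_trans sZ _)).
  by rewrite leqW // leq_addr.
have conn_of x x' : x < x' -> C (x :: e) -> x \notin Z -> x' \notin Z ->
    count (fun z => (z < x)%R) Z = count (fun z => (z < x')%R) Z -> regular_between e x x'.
  move=> xx' Cx xZ x'Z; rewrite (count_between Z (ltW xx')) => cnt.
  have /eqP : count (fun z => (x <= z)%R && (z < x')%R) Z = 0%N by lia.
  rewrite eqn0Ngt -has_count => /hasPn noZ.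
  have av : avoids Z x x'.
    move=> u uZ; apply/negP => /andP[u1]; rewrite le_eqVlt => /orP[/eqP ux'|u2].
      by move: x'Z; rewrite -ux' uZ.
    by have := noZ u uZ; rewrite u1 u2.
  have cst i u v : (i < k.+2)%N -> x <= u <= x' -> x <= v <= x' ->
      A i (u :: e) -> A i (v :: e).
    move=> ik /andP[u1 u2] /andP[v1 v2]; have [uv|/ltW vu] := leP u v.
      by move/(HZ i u v ik uv (avoids_sub u1 v2 av)).
    by move/(HZ i v u ik vu (avoids_sub v1 u2 av)).
  have xin : x <= x <= x' by rewrite lexx ltW.
  split=> //; split.
    (* All [F i] are continuous together at some point [a] of the interval, and regularity, being
       among the conditions that are constant there, spreads from [a] to every point. *)
    have [a [b [h1 h2 h3 Hc]]] := @common_continuous k (fun i y => F i (y :: e)) x x'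
      (fun i ik => dfun1P e (dF ik)) xx'.
    have ain : x <= a <= x' by lra.
    have ga : regular_at e a.
      split=> [|i ik]; first exact: (@cst 0%N x a).
      by apply: Hc => //; lra.
    by move=> u /andP uin; apply: (@cst 1%N a u).
  move=> i ik; have [Fx|Fx] := pselect (F i (x :: e) = 0); [left|right] => u /andP uin.
    exact: (@cst i.+2 x u).
  by move/(@cst i.+2 u x ik uin xin).
case: ifPn => yZ; case: ifPn => zZ.
- by move=> E; left; rewrite -(nth_index 0 yZ) E nth_index.
- by move=> E; move: yZ; rewrite -index_mem E ltnNge leq_addr.
- by move=> E; move: zZ; rewrite -index_mem -E ltnNge leq_addr.
move=> /addnI E; have [yz|zy|->] := ltgtP y z; last by left.
  by right; left; apply: conn_of.
by right; right; apply: conn_of.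
Qed.

Hypothesis IH : forall (F' : nat -> seq M -> M) (C' : seq M -> Prop) (f' : seq M -> bool),
  (forall i, (i < k)%N -> definable_fun (F' i)) -> definable C' -> trop_locally_constant m k F' C' f' ->
  exists B, definable B /\ forall e, size e = m -> C' e -> (f' e <-> B e).

(** Induction on the number [N] of labels occurring in a fibre. The value of [f] at a definably
    chosen point [s e] is definable in [e] by the hypothesis in dimension [m], and it is also the
    value on the piece of [s e]. Removing that piece from [C'] removes a label. The labelling only
    serves to count and may vary arbitrarily with [e]. *)
Lemma def_by_pieces N (C' : seq M -> Prop) : definable C' -> (forall e, C' e -> C e) ->
  (forall e, size e = m -> exists (kappa : M -> nat) (L : seq nat), [/\ (size L <= N)%N,
     forall y, C' (y :: e) -> kappa y \in L &
     forall y z, C' (y :: e) -> C' (z :: e) -> kappa y = kappa z -> same_piece e y z]) ->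
  exists B, definable B /\ forall y e, size e = m -> C' (y :: e) -> (f (y :: e) <-> B (y :: e)).
Proof.
elim: N C' => [|N IHN] C' dC' C'C HC'.
  exists (fun=> False); split; first exact: def_const.
  move=> y e se Cy; have [kappa [[|? ?] [// _ H _]]] := HC' e se.
  by have := H y Cy.
have [s [ds Cs]] := def_choice dC'.
pose C1 e := exists y, C' (y :: e).
have dC1 : definable C1.
  rewrite /C1; def_tac.
  by apply: (def_sub dC'); apply: dsub_consn; dsub_tac.
have [||B1 [dB1 HB1]] := IH (F' := fun i e => F i (s e :: e))
    (f' := fun e => f (s e :: e)) _ dC1.
- by move=> i ik; apply: (dfun_cons ds (dF ik)); exact: dsub_id.
- move=> e se C1e; have [|d d0 Hd] := fF _ (C'C _ (Cs e C1e)); first by rewrite /= se.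
  by exists d => // e' se' C1e'; apply: Hd; [rewrite /= se'|apply/C'C/Cs].
pose E e := same_piece (behead e) (s (behead e)) e`_0.
have dE : definable E by exact: def_same_piece.
have [||e se|B2 [dB2 HB2]] := IHN (fun e => C' e /\ ~ E e).
- by apply: def_and => //; exact: def_not.
- by move=> e [/C'C].
- have [kappa [L [sL HL Heqv]]] := HC' e se.
  have [C1e|nC1] := pselect (C1 e); last first.
    exists kappa, [::]; split=> // y; last by move=> z [Cy _]; case: nC1; exists y.
    by move=> [Cy _]; case: nC1; exists y.
  (* All points with the label of [s e] lie in its piece, so this label disappears from the
     remaining set. *)
  exists kappa, [seq i <- L | i != kappa (s e)]; split.
  - rewrite size_filter -ltnS; apply: leq_trans sL.
    rewrite -[X in (_ < X)%N](count_predC (fun i => i != kappa (s e))).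
    rewrite -[X in (X < _)%N]addn0 ltn_add2l -has_count; apply/hasP.
    by exists (kappa (s e)); [apply/HL/Cs|rewrite /= eqxx].
  - move=> y [Cy nE]; rewrite mem_filter HL // andbT; apply/eqP => kE; apply: nE.
    by apply: Heqv => //; apply: Cs.
  - by move=> y z [Cy _] [Cz _]; exact: Heqv.
exists (fun e => E e /\ B1 (behead e) \/ ~ E e /\ B2 e); split.
  def_tac => //; apply: (def_sub dB1); exact: (dsub_behead (dsub_id _)).
move=> y e se Cy; have [Ey|nEy] := pselect (E (y :: e)).
  have C1e : C1 e by exists y.
  rewrite -(same_piece_eq se Ey) (HB1 e se C1e) /=.
  by split=> [?|[[]|[]]] //; left.
rewrite (HB2 y e se (conj Cy nEy)) /=.
by split=> [?|[[]|[]]] //; right.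
Qed.

Lemma trop_step : exists B, definable B /\ forall e, size e = m.+1 -> C e -> (f e <-> B e).
Proof.
have [N HN] := same_piece_finite.
have [//|//|e se|B [dB HB]] := @def_by_pieces N C.
  have [kappa [k1 k2]] := HN e; exists kappa, (iota 0 N).
  by rewrite size_iota; split=> // y _; rewrite mem_iota k1.
by exists B; split=> // -[|y e] //= [se]; apply: HB.
Qed.

End Step.

Theorem trop_locally_constant_def m k (F : nat -> seq M -> M) (C : seq M -> Prop)
    (f : seq M -> bool) :
  (forall i, (i < k)%N -> definable_fun (F i)) -> definable C -> trop_locally_constant m k F C f ->
  exists B, definable B /\ forall e, size e = m -> C e -> (f e <-> B e).
Proof.
elim: m F C f => [|m IH] F C f dF dC fF; last exact: trop_step fF IH.
exists (fun=> f [::]); split; first exact: def_const.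
by move=> e /size0nil ->.
Qed.

End TropInduction.

(** * Transfer from [M] to [K] *)

Section Transfer.

Variables (K M : rcfType) (iota : {rmorphism K -> M}) (n : nat).

Definition row_of_seq (F : rcfType) (e : seq F) : 'rV[F]_n := \row_i e`_i.

Definition seq_of_row (F : rcfType) (x : 'rV[F]_n) : seq F := [seq x ord0 i | i <- enum 'I_n].

Lemma size_seq_of_row (F : rcfType) (x : 'rV[F]_n) : size (seq_of_row x) = n.
Proof. by rewrite size_map size_enum_ord. Qed.

Lemma nth_seq_of_row (F : rcfType) (x : 'rV[F]_n) (i : 'I_n) : (seq_of_row x)`_i = x ord0 i.
Proof. by rewrite (nth_map i) ?size_enum_ord // nth_ord_enum. Qed.

Lemma row_of_seqK (F : rcfType) (x : 'rV[F]_n) e : row_of_seq (seq_of_row x ++ e) = x.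
Proof.
apply/rowP => i; rewrite mxE nth_cat size_seq_of_row ltn_ord nth_seq_of_row.
by congr (x _ _); apply: val_inj.
Qed.

Lemma pterm_ext (s s' : seq K -> K) (t t' : seq M -> M) :
  (forall e, s' e = s e) -> (forall e, t' e = t e) ->
  polynomial_pair iota s t -> polynomial_pair iota s' t'.
Proof. by move=> ss tt [u [us ut]]; exists u; split=> e; rewrite ?ss ?tt. Qed.

Lemma ptermX s t k : polynomial_pair iota s t -> polynomial_pair iota (fun e => s e ^+ k) (fun e => t e ^+ k).
Proof. by move=> [u [us ut]]; exists (qe_rcf.Exp u k); split=> e /=; rewrite ?us ?ut. Qed.

Lemma pterm_prod (I : Type) (r : seq I) (s : I -> seq K -> K) (t : I -> seq M -> M) :
  (forall i, polynomial_pair iota (s i) (t i)) ->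
  polynomial_pair iota (fun e => \prod_(i <- r) s i e) (fun e => \prod_(i <- r) t i e).
Proof.
move=> H; elim: r => [|i r IH].
  by apply: pterm_ext (pterm_nat iota 1) => e; rewrite big_nil.
by apply: pterm_ext (ptermM (H i) IH) => e; rewrite big_cons.
Qed.

Lemma pterm_meval (p : mpoly n K) :
  polynomial_pair iota (fun e => meval (fun i => row_of_seq e ord0 i) p)
             (fun e => meval (fun i => row_of_seq e ord0 i) (map_mpoly iota p)).
Proof.
elim/mpolyind: p => [|c m p _ _ IH].
  apply: pterm_ext (pterm_nat iota 0) => e; first by rewrite raddf0.
  by rewrite !raddf0.
have Xm : polynomial_pair iota (fun e => meval (fun i => row_of_seq e ord0 i) (mpolyX K m))
                (fun e => meval (fun i => row_of_seq e ord0 i) (mpolyX M m)).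
  have vi i : polynomial_pair iota (fun e => row_of_seq e ord0 i) (fun e => row_of_seq e ord0 i).
    by apply: pterm_ext (pterm_nth i (psub_id iota)) => e; rewrite mxE.
  apply: (pterm_ext _ _ (pterm_prod (index_enum _) (fun i => ptermX (m i) (vi i)))) => e;
    exact: mevalX.
apply: pterm_ext (ptermD (ptermM (pterm_const iota c) Xm) IH) => e.
  by rewrite mevalD mevalZ.
by rewrite raddfD mevalD /= map_mpolyZ mevalZ map_mpolyX.
Qed.

Lemma pdef_sa (phi : sa_desc K n) :
  definable_pair iota (fun e => sa_holds (row_of_seq e) phi) (fun e => sa_holds (row_of_seq e) (sa_map iota phi)).
Proof.
elim: phi => [p|p IH|p IHp q IHq|p IHp q IHq] /=.
- apply: pdef_lt; last exact: pterm_meval.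
  exact: (pterm_nat iota 0).
- by apply: pdef_iff (pdef_not IH) => e; split=> /negP.
- by apply: pdef_iff (pdef_and IHp IHq) => e; split=> /andP.
- by apply: pdef_iff (pdef_or IHp IHq) => e; split=> /orP.
Qed.

Lemma term_mpoly (t : qf_term K) : exists p : mpoly n K, forall x : 'rV[K]_n,
  meval (fun i => x ord0 i) p = qe_rcf.eval (seq_of_row x) t.
Proof.
elim: t => /= [i|c|k|a [p Hp] b [q Hq]|a [p Hp]|a [p Hp] k|a [p Hp] b [q Hq]|a [p Hp] k].
- have [ni|ni] := ltnP i n.
    exists (mpolyX K (mnm1 (Ordinal ni))) => x.
    by rewrite mevalXU -nth_seq_of_row.
  by exists 0 => x; rewrite raddf0 nth_default // size_seq_of_row.
- by exists (mpolyC n c) => x; rewrite mevalC.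
- by exists (mpolyC n k%:R) => x; rewrite mevalC.
- by exists (p + q) => x; rewrite mevalD Hp Hq.
- by exists (- p) => x; rewrite raddfN /= Hp.
- by exists (p *+ k) => x; rewrite raddfMn /= Hp.
- by exists (p * q) => x; rewrite mevalM Hp Hq.
- by exists (p ^+ k) => x; rewrite rmorphXn /= Hp.
Qed.

Lemma formula_sa (f : qf_formula K) : exists psi : sa_desc K n, forall x : 'rV[K]_n,
  sa_holds x psi = qe_rcf.qf_eval (seq_of_row x) f.
Proof.
have lt (a b : qf_term K) : exists psi : sa_desc K n, forall x : 'rV[K]_n,
    sa_holds x psi = (qe_rcf.eval (seq_of_row x) a < qe_rcf.eval (seq_of_row x) b).
  have [p Hp] := term_mpoly (qe_rcf.Add b (qe_rcf.Opp a)).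
  by exists (SApos p) => x; rewrite /= Hp /= subr_gt0.
elim: f => /= [b|a b|a b|a b|f [p Hp] g [q Hq]|f [p Hp] g [q Hq]|f [p Hp] g [q Hq]|f [p Hp]].
- case: b; last by exists (SApos 0) => x /=; rewrite raddf0 ltxx.
  by exists (SApos 1) => x /=; rewrite rmorph1 ltr01.
- have [p Hp] := lt a b; have [q Hq] := lt b a.
  by exists (SAand (SAnot p) (SAnot q)) => x; rewrite /= Hp Hq; case: ltgtP.
- exact: lt.
- by have [p Hp] := lt b a; exists (SAnot p) => x; rewrite /= Hp -leNgt.
- by exists (SAand p q) => x /=; rewrite Hp Hq.
- by exists (SAor p q) => x /=; rewrite Hp Hq.
- by exists (SAor (SAnot p) q) => x /=; rewrite Hp Hq implybE.
- by exists (SAnot p) => x /=; rewrite Hp.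
Qed.

Lemma eval_mor e (t : qf_term K) : qe_rcf.eval (map iota e) (term_map iota t) = iota (qe_rcf.eval e t).
Proof.
elim: t => /= [i|c|k|a -> b ->|a ->|a -> k|a -> b ->|a -> k].
- by elim: e i => [|a e IH] [|i] //=; rewrite rmorph0.
- by [].
- by rewrite rmorph_nat.
- by rewrite rmorphD.
- by rewrite rmorphN.
- by rewrite rmorphMn.
- by rewrite rmorphM.
- by rewrite rmorphXn.
Qed.

(** Nonnegative elements are squares, and morphisms preserve squares. *)
Lemma rcf_rmorph_le x y : (iota x <= iota y) = (x <= y).
Proof.
have H u v : u <= v -> iota u <= iota v.
  rewrite -subr_ge0 -[iota u <= _]subr_ge0 -rmorphB => uv.
  by rewrite -[v - u]sqr_sqrtr // rmorphXn sqr_ge0.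
apply/idP/idP => [xy|]; last exact: H.
rewrite leNgt; apply/negP => yx; move: (H _ _ (ltW yx)) => yx'.
have /fmorph_inj E : iota x = iota y by apply/eqP; rewrite eq_le xy.
by rewrite E ltxx in yx.
Qed.

Lemma qf_eval_mor e (f : qf_formula K) :
  qe_rcf.qf_eval (map iota e) (formula_map iota f) = qe_rcf.qf_eval e f.
Proof.
elim: f => //= [a b|a b|a b|a -> b ->|a -> b ->|a -> b ->|a ->] //; rewrite !eval_mor.
- exact: fmorph_eq.
- by rewrite !ltNge rcf_rmorph_le.
- exact: rcf_rmorph_le.
Qed.

(** The transfer principle: at the empty environment a quantifier-free formula compares elements of
    [K] only, and [iota] preserves these comparisons. *)
Lemma pdef_nil A B : definable_pair iota A B -> B [::] -> A [::].
Proof. by move=> [f [fA fB]] /fB; rewrite -[[::]]/(map iota [::]) qf_eval_mor => /fA. Qed.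

(* The constants [c1] of [t] become variables; [c0] and [c2] leave room for those of
   the other subterms. *)
Lemma term_abstract (t : qf_term M) c0 : exists (c1 : seq M) (t0 : qf_term K), forall c2 e,
  size e = n -> qe_rcf.eval (e ++ c0 ++ c1 ++ c2) (term_map iota t0) = qe_rcf.eval e t.
Proof.
elim: t c0 => [i|c|k|a IHa b IHb|a IHa|a IHa k|a IHa b IHb|a IHa k] c0.
- have [ni|ni] := ltnP i n.
    by exists [::], (qe_rcf.Var _ i) => c2 e se /=; rewrite nth_cat se ni.
  by exists [::], (qe_rcf.NatConst _ 0) => c2 e se /=; rewrite nth_default // se.
- exists [:: c], (qe_rcf.Var _ (n + size c0)) => c2 e se /=.
  by rewrite !nth_cat se ltnNge leq_addr /= addKn ltnn subnn.
- by exists [::], (qe_rcf.NatConst _ k).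
- have [c1 [a0 Ha]] := IHa c0; have [c1' [b0 Hb]] := IHb (c0 ++ c1).
  exists (c1 ++ c1'), (qe_rcf.Add a0 b0) => c2 e se /=.
  by have := Hb c2 e se; rewrite -!catA Ha // => ->.
- by have [c1 [a0 Ha]] := IHa c0; exists c1, (qe_rcf.Opp a0) => c2 e se /=; rewrite Ha.
- by have [c1 [a0 Ha]] := IHa c0; exists c1, (qe_rcf.NatMul a0 k) => c2 e se /=; rewrite Ha.
- have [c1 [a0 Ha]] := IHa c0; have [c1' [b0 Hb]] := IHb (c0 ++ c1).
  exists (c1 ++ c1'), (qe_rcf.Mul a0 b0) => c2 e se /=.
  by have := Hb c2 e se; rewrite -!catA Ha // => ->.
- by have [c1 [a0 Ha]] := IHa c0; exists c1, (qe_rcf.Exp a0 k) => c2 e se /=; rewrite Ha.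
Qed.

Lemma formula_abstract (f : qf_formula M) c0 : exists (c1 : seq M) (f0 : qf_formula K), forall c2 e,
  size e = n -> qe_rcf.qf_eval (e ++ c0 ++ c1 ++ c2) (formula_map iota f0) = qe_rcf.qf_eval e f.
Proof.
elim: f c0 => [b|a b|a b|a b|f IHf g IHg|f IHf g IHg|f IHf g IHg|f IHf] c0.
- by exists [::], (qe_rcf.Bool b).
- have [c1 [a0 Ha]] := term_abstract a c0; have [c1' [b0 Hb]] := term_abstract b (c0 ++ c1).
  exists (c1 ++ c1'), (qe_rcf.Equal a0 b0) => c2 e se /=.
  by have := Hb c2 e se; rewrite -!catA Ha // => ->.
- have [c1 [a0 Ha]] := term_abstract a c0; have [c1' [b0 Hb]] := term_abstract b (c0 ++ c1).
  exists (c1 ++ c1'), (qe_rcf.Lt a0 b0) => c2 e se /=.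
  by have := Hb c2 e se; rewrite -!catA Ha // => ->.
- have [c1 [a0 Ha]] := term_abstract a c0; have [c1' [b0 Hb]] := term_abstract b (c0 ++ c1).
  exists (c1 ++ c1'), (qe_rcf.Le a0 b0) => c2 e se /=.
  by have := Hb c2 e se; rewrite -!catA Ha // => ->.
- have [c1 [a0 Ha]] := IHf c0; have [c1' [b0 Hb]] := IHg (c0 ++ c1).
  exists (c1 ++ c1'), (qe_rcf.And a0 b0) => c2 e se /=.
  by have := Hb c2 e se; rewrite -!catA Ha // => ->.
- have [c1 [a0 Ha]] := IHf c0; have [c1' [b0 Hb]] := IHg (c0 ++ c1).
  exists (c1 ++ c1'), (qe_rcf.Or a0 b0) => c2 e se /=.
  by have := Hb c2 e se; rewrite -!catA Ha // => ->.
- have [c1 [a0 Ha]] := IHf c0; have [c1' [b0 Hb]] := IHg (c0 ++ c1).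
  exists (c1 ++ c1'), (qe_rcf.Implies a0 b0) => c2 e se /=.
  by have := Hb c2 e se; rewrite -!catA Ha // => ->.
- by have [c1 [a0 Ha]] := IHf c0; exists c1, (qe_rcf.Not a0) => c2 e se /=; rewrite Ha.
Qed.

Lemma pdef_exn k A B : definable_pair iota A B ->
  definable_pair iota (fun e => exists x, size x = k /\ A (x ++ e))
            (fun e => exists x, size x = k /\ B (x ++ e)).
Proof.
have E (F : Type) (P : seq F -> Prop) j e :
    (exists y x, size x = j /\ P (x ++ y :: e)) <-> exists x, size x = j.+1 /\ P (x ++ e).
  split=> [[y [x [sx Px]]]|[x]].
    by exists (rcons x y); rewrite size_rcons sx cat_rcons.
  by case/lastP: x => [[]|x y] //; rewrite size_rcons cat_rcons => -[[sx] Px]; exists y, x.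
move=> AB; elim: k => [|k IH].
  apply: pdef_iff AB => e; split=> [H|[x [/size0nil ->]]] //; by exists [::].
have : definable_pair iota (fun e => exists y x, size x = k /\ A (x ++ y :: e))
                 (fun e => exists y x, size x = k /\ B (x ++ y :: e)).
  apply: (@pdef_ex _ _ _ (fun e y => exists x, size x = k /\ A (x ++ y :: e))
                         (fun e y => exists x, size x = k /\ B (x ++ y :: e))).
  have sb : subst_pair iota (fun e => e`_0 :: behead e) (fun e => e`_0 :: behead e).
    apply: psub_cons; first exact: pterm_nth (psub_id _).
    exact: psub_behead (psub_id _).
  exact: (pdef_sub IH sb).
by apply: pdef_iff => e; exact: E.
Qed.

(** [mkseq] gives the first block length [n] even when [e] is shorter, in accordance with the
    padding by zeros. *)
Definition drop_middle k (F : rcfType) (e : seq F) := mkseq (nth 0 e) n ++ drop k e.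

Lemma psub_drop_middle k : subst_pair iota (@drop_middle k K) (@drop_middle k M).
Proof.
exists (fun i => qe_rcf.Var _ (if (i < n)%N then i else k + (i - n))%N).
by split=> e i; rewrite /drop_middle nth_cat size_mkseq; case: ltnP => ni /=;
   rewrite ?nth_mkseq // nth_drop.
Qed.

Lemma drop_middle_cat (F : rcfType) k (y z e : seq F) : size y = n -> k = (n + size z)%N ->
  drop_middle k (y ++ z ++ e) = y ++ e.
Proof.
move=> sy ->; rewrite /drop_middle catA drop_size_cat ?size_cat ?sy //; congr (_ ++ _).
apply: (@eq_from_nth _ 0); rewrite size_mkseq ?sy // => i ni.
by rewrite nth_mkseq // -catA nth_cat sy ni.
Qed.

(* [jumps e], for [e = y ++ r :: x ++ c]: the point [y] of [S] is at distance less
   than [r] of [x] and [q (y ++ c)] and [q (x ++ c)] differ. *)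
Definition jumps (F : rcfType) (S q : seq F -> Prop) (e : seq F) :=
  S e /\ (forall i, (i < n)%N -> e`_i - (drop n.+1 e)`_i < e`_n /\
                               (drop n.+1 e)`_i - e`_i < e`_n) /\
  ~ (q (drop_middle (n + n.+1) e) <-> q (drop n.+1 e)).

(** For [e = x ++ c] this says that [q], with parameters [c], is not locally constant on [S] at the
    point [x]. *)
Definition jump_point (F : rcfType) (S q : seq F -> Prop) (e : seq F) :=
  S e /\ ~ exists r, 0 < r /\ ~ exists y, size y = n /\ jumps S q (y ++ r :: e).

(** First-order form of a disconnection: with parameters [c], [q] takes both values on [S] and is
    locally constant there, so both parts are relatively open. *)
Definition splits (F : rcfType) (S q : seq F -> Prop) (c : seq F) :=
  (exists x, size x = n /\ (S (x ++ c) /\ q (x ++ c))) /\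
  (exists x, size x = n /\ (S (x ++ c) /\ ~ q (x ++ c))) /\
  ~ exists x, size x = n /\ jump_point S q (x ++ c).

Lemma pdef_splits S q S' q' : definable_pair iota S S' -> definable_pair iota q q' ->
  definable_pair iota (splits S q) (splits S' q').
Proof.
move=> dS dq; have sd : subst_pair iota (fun e => drop n.+1 e) (fun e => drop n.+1 e).
  exact: psub_drop (psub_id _).
have tn i : polynomial_pair iota (fun e => e`_i) (fun e => e`_i) by exact: pterm_nth (psub_id _).
have td i : polynomial_pair iota (fun e => (drop n.+1 e)`_i) (fun e => (drop n.+1 e)`_i).
  exact: pterm_nth sd.
apply: pdef_and; first exact: (pdef_exn n (pdef_and dS dq)).
apply: pdef_and; first exact: (pdef_exn n (pdef_and dS (pdef_not dq))).
suff dj : definable_pair iota (jump_point S q) (jump_point S' q').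
  exact: (pdef_not (pdef_exn n dj)).
apply: pdef_and => //; apply: pdef_not.
apply: (@pdef_ex _ _ _
  (fun e r => 0 < r /\ ~ exists y, size y = n /\ jumps S q (y ++ r :: e))
  (fun e r => 0 < r /\ ~ exists y, size y = n /\ jumps S' q' (y ++ r :: e))).
apply: pdef_and; first by apply: pdef_lt => //; exact: (pterm_nat iota 0).
apply: pdef_not.
have sb : subst_pair iota (fun e => e`_0 :: behead e) (fun e => e`_0 :: behead e).
  by apply: psub_cons => //; exact: psub_behead (psub_id _).
suff dj : definable_pair iota (jumps S q) (jumps S' q').
  exact: (pdef_sub (pdef_exn n dj) sb).
apply: pdef_and => //; apply: pdef_and.
  apply: (@pdef_ball _ _ _ n
    (fun i e => e`_i - (drop n.+1 e)`_i < e`_n /\ (drop n.+1 e)`_i - e`_i < e`_n)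
    (fun i e => e`_i - (drop n.+1 e)`_i < e`_n /\ (drop n.+1 e)`_i - e`_i < e`_n)).
  by move=> i _; apply: pdef_and; apply: pdef_lt => //; apply: ptermB.
apply: pdef_not; apply: pdef_equiv; last exact: pdef_sub.
by apply: pdef_sub => //; exact: psub_drop_middle.
Qed.

Lemma jumpsE (F : rcfType) (S q : seq F -> Prop) x y c r : size x = n -> size y = n ->
  jumps S q (y ++ r :: x ++ c) <->
  [/\ S (y ++ r :: x ++ c), forall i, (i < n)%N -> `|y`_i - x`_i| < r
    & ~ (q (y ++ c) <-> q (x ++ c))].
Proof.
move=> sx sy; rewrite /jumps -[r :: x ++ c]/([:: r] ++ x ++ c).
have -> : drop n.+1 (y ++ [:: r] ++ x ++ c) = x ++ c.
  by rewrite catA drop_size_cat // size_cat sy addn1.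
rewrite [[:: r] ++ _]catA drop_middle_cat ?size_cat ?sx ?addn1 //= ?add1n //.
rewrite [(y ++ _)`_n]nth_cat sy ltnn subnn /=.
split=> [[Sy [H nq]]|[Sy H nq]]; split=> //; last first.
  split=> // i ni; rewrite !nth_cat sx sy ni.
  by have := H i ni; rewrite ltr_norml => /andP[? ?]; split; lra.
move=> i ni; have := H i ni; rewrite !nth_cat sx sy ni => -[? ?].
by rewrite ltr_norml; apply/andP; split; lra.
Qed.

End Transfer.

(** * From a splitting of the tropicalization to a splitting of [S] *)

Lemma row_of_seq_cat (F : rcfType) n (x e : seq F) : size x = n -> row_of_seq n (x ++ e) = row_of_seq n x.
Proof. by move=> sx; apply/rowP => i; rewrite !mxE nth_cat sx ltn_ord. Qed.

Lemma seq_of_rowK (F : rcfType) n (x : seq F) : size x = n -> seq_of_row (row_of_seq n x) = x.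
Proof.
move=> sx; apply: (@eq_from_nth _ 0) => [|i]; rewrite size_seq_of_row ?sx // => ni.
by rewrite (nth_seq_of_row _ (Ordinal ni)) mxE.
Qed.

(** The witness is the interior of the union of [A] with the complement of [S], the largest open set
    whose trace on [S] lies in [A]. *)
Lemma relatively_open_ball (K : rcfType) n (S A : set 'rV[K]_n) :
  A `<=` S -> (forall x, A x -> exists2 r : K, 0 < r &
     forall y, S y -> (forall i, `|y ord0 i - x ord0 i| < r) -> A y) ->
  relatively_open S A.
Proof.
move=> AS loc; exists (~` S `|` A)°; first exact: open_interior.
apply/seteqP; split=> [x Ax|x [Sx]]; last by move/interior_subset => [].
split; first exact: AS.
have [r r0 Hr] := loc x Ax; apply/nbhs_ballP; exists r => //= y [_ xy].
have [Sy|nSy] := pselect (S y); [right|by left].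
by apply: Hr => // i; rewrite distrC; have := xy ord0 i.
Qed.

Section SignedAbsval.

Variables (R : realType) (M : rcfType) (w : M -> R).
Hypothesis wP : compatible_nonarch_absval w.
Hypothesis w_surj : forall r : R, 0 <= r -> exists x, w x = r.

(** Away from 0 the map is locally constant by [w_near]. At 0 the radius is an element of absolute
    value [d / 2]. This is how local constancy on the tropical side passes to the order topology of
    [M]. *)
Lemma sabs_continuous (x : M) (d : R) : 0 < d ->
  exists2 r, 0 < r & forall y, `|y - x| < r -> `|signed_abs w y - signed_abs w x| < d.
Proof.
move=> d0; have near z : 0 < z -> forall y, `|y - z| < z / 2 -> signed_abs w y = signed_abs w z.
  by move=> z0 y /(w_near wP z0) [y0 wyz]; rewrite !sabs_pos.
have [x0|x0|->] := ltrgt0P x.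
- exists (x / 2); first exact: divr_gt0.
  by move=> y /(near _ x0) ->; rewrite subrr normr0.
- have nx0 : 0 < - x by rewrite oppr_gt0.
  exists (- x / 2); first exact: divr_gt0.
  move=> y yx; have : signed_abs w (- y) = signed_abs w (- x).
    by apply: near => //; rewrite -opprD normrN.
  by rewrite !(sabsN wP) => /oppr_inj ->; rewrite subrr normr0.
have [r r0 wr] := w_surj_pos wP w_surj (divr_gt0 d0 (ltr0n _ 2)).
exists r => // y; rewrite subr0 (sabs0 w) subr0 => yr.
have -> : `|signed_abs w y| = w `|y|.
  rewrite /signed_abs; have [y0|y0|->] := ltrgt0P y.
  - by rewrite gtr0_sgz // mul1r gtr0_norm // (w_gt0 wP) // gt_eqF.
  - rewrite ltr0_sgz // mulN1r normrN gtr0_norm ?(wN wP) //.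
    by rewrite (w_gt0 wP) // lt_eqF.
  by rewrite sgz0 mul0r normr0 (w0 wP).
have := w_mono wP (normr_ge0 y) (ltW yr); rewrite wr => h.
by apply: le_lt_trans h _; lra.
Qed.

End SignedAbsval.

Theorem corollary6p10 (R : realType) (K : rcfType) (v : K -> R)
    (v_absval : compatible_nonarch_absval v)
    (n : nat) (S : set 'rV[K]_n) (phi : sa_desc K n) (S_phi : S = sa_set phi)
    (M : rcfType) (iota : {rmorphism K -> M}) (w : M -> R)
    (M_ext : trop_extension v iota w) :
  sa_connected S -> connected (real_trop iota w phi).
Proof.
move=> S_conn B0 B0_neq0 [U openU B0U] [V closedV B0V]; apply: contrapT => B0_neqT.
have [wP _ w_surj] := M_ext.
set T := real_trop iota w phi in B0U B0V B0_neqT.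
pose C (e : seq M) : Prop := sa_holds (row_of_seq n e) (sa_map iota phi).
pose trop (e : seq M) := signed_absval w (row_of_seq n e).
pose f (e : seq M) := `[< U (trop e) >].
have tropE e i (ni : (i < n)%N) : trop e ord0 (Ordinal ni) = signed_abs w e`_i.
  by rewrite /trop /signed_absval !mxE.
have TC e : C e -> T (trop e) by move=> Ce; exists (row_of_seq n e).
(* [B0] is the trace on [T] of the open [U] and of the closed [V]. Membership is thus an open
   condition through [U], and its failure one through the complement of [V]. *)
have UV e : C e -> U (trop e) <-> V (trop e).
  move=> /TC Te; split=> H.
    by have : (T `&` U) (trop e) by []; rewrite -B0U B0V => -[].
  by have : (T `&` V) (trop e) by []; rewrite -B0V B0U => -[].
have [psi psiP] : exists g : qf_formula M, forall e, C e <-> qe_rcf.qf_eval e g.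
  by have [g [_ gP]] := pdef_sa iota phi; exists (formula_map iota g).
have near_trop (e : seq M) (W : set 'rV[R]_n) : open W -> W (trop e) ->
    exists2 d : R, 0 < d & forall e', (forall i, (i < n)%N ->
      `|signed_abs w e'`_i - signed_abs w e`_i| < d) -> W (trop e').
  move=> openW We; have /nbhs_ballP [d /= d0 Hd] : nbhs (trop e) W.
    exact: open_nbhs_nbhs.
  exists d => // e' He'; apply: Hd; split=> // a b; rewrite ord1; case: b => b nb.
  by rewrite !tropE /ball /= distrC; apply: He'.
have f_loc : trop_locally_constant w n n (fun i e => e`_i) C f.
  move=> e se Ce; rewrite /f; have [Ue|nUe] := asboolP (U (trop e)).
    have [d d0 Hd] := near_trop e U openU Ue; exists d => // e' se' Ce' He'.
    by apply/asboolP/Hd.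
  have nVe : (~` V) (trop e) by move/(UV e Ce).
  have [d d0 Hd] := near_trop e (~` V) (closed_openC closedV) nVe.
  exists d => // e' se' Ce' He'; apply/asboolP => /(UV e' Ce').
  exact: Hd.
have [B [dB HB]] := trop_locally_constant_def wP w_surj
  (fun i _ => dfun_nth i (dsub_id _)) ((defP _).2 (ex_intro _ psi psiP)) f_loc.
have [fB fBP] := (defP _).1 dB.
have [c1 [f0 Hf0]] := formula_abstract iota n fB [::].
pose q (e : seq K) : Prop := qe_rcf.qf_eval e f0.
pose q' (e : seq M) : Prop := qe_rcf.qf_eval e (formula_map iota f0).
have dq : definable_pair iota q q' by exists f0.
have q'E x : size x = n -> C x -> q' (x ++ c1) <-> U (trop x).
  move=> sx Cx; rewrite /q'; have := Hf0 [::] x sx; rewrite cats0 => ->.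
  by rewrite -fBP -HB // /f; split=> /asboolP.
have splitsM : splits n C q' c1.
  have Ccat x : size x = n -> C (x ++ c1) <-> C x by move=> sx; rewrite /C row_of_seq_cat.
  have ptT t : T t -> exists x, [/\ size x = n, C x & trop x = t].
    move=> [x Sx <-]; exists (seq_of_row x).
    by rewrite size_seq_of_row /C /trop -[seq_of_row x]cats0 row_of_seqK.
  split.
    have [t B0t] := B0_neq0; have [Tt Ut] : (T `&` U) t by rewrite -B0U.
    have [x [sx Cx xt]] := ptT t Tt; exists x; split=> //.
    by split; [apply/Ccat|apply/q'E => //; rewrite xt].
  split.
    have [t [Tt nB0t]] : exists t, T t /\ ~ B0 t.
      apply: contrapT => H; apply: B0_neqT; apply/seteqP; split=> [t|t Tt].
        by rewrite B0U => -[].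
      by apply: contrapT => nB0t; apply: H; exists t.
    have [x [sx Cx xt]] := ptT t Tt; exists x; split=> //.
    split; [exact/Ccat|move/q'E; rewrite xt => /(_ sx Cx) Ut].
    by apply: nB0t; rewrite B0U.
  move=> [x [sx [/Ccat Cx nr]]]; have {}Cx := Cx sx; apply: nr.
  have [d d0 Hd] := f_loc x sx Cx.
  (* [finite_ball] has a single centre in [M], so the different coordinates are treated through
     increments around 0. *)
  have [r r0 Hr] : exists2 r, 0 < r & forall y : M, `|y| < r -> forall i, (i < n)%N ->
      `|signed_abs w (x`_i + y) - signed_abs w x`_i| < d.
    suff [r r0 Hr] : exists2 r, 0 < r & forall y : M, `|y - 0| < r -> forall i, (i < n)%N ->
        `|signed_abs w (x`_i + y) - signed_abs w x`_i| < d.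
      by exists r => // y yr; apply: Hr; rewrite subr0.
    apply: (@finite_ball _ n (fun i y => `|signed_abs w (x`_i + y) - signed_abs w x`_i| < d)) => i _.
    have [r r0 Hr] := sabs_continuous wP w_surj x`_i d0; exists r => // y yr.
    by apply: Hr; rewrite addrC addKr -[y]subr0.
  exists r; split=> // -[y [sy /(jumpsE C q' c1 r sx sy) [Cy yx]]]; apply.
  have {}Cy : C y by move: Cy; rewrite /C row_of_seq_cat.
  have : f y = f x.
    apply: Hd => // i ni; have := Hr (y`_i - x`_i) (yx i ni) i ni.
    by rewrite [x`_i + _]addrC subrK.
  rewrite !q'E // => fyx; split=> /asboolP.
    by rewrite -/(f y) fyx => /asboolP.
  by rewrite -/(f x) -fyx => /asboolP.
(* Quantifying the parameters [c1] closes the statement, which then descends to [K] and yields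
   parameters [c] there. *)
have [c [sc]] : exists c, size c = size c1 /\
    splits n (fun e => sa_holds (row_of_seq n e) phi) q (c ++ [::]).
  apply: (pdef_nil (pdef_exn (size c1) (pdef_splits n (pdef_sa iota phi) dq))).
  by exists c1; rewrite cats0.
rewrite cats0 => -[[x [sx [Sx qx]]] [[y [sy [Sy nqy]]] nojump]].
(* The parameters found in [K] are substituted for the variables of index at least [n]. *)
have [chi chiP] := formula_sa n
  (formula_subst (fun i => if (i < n)%N then qe_rcf.Var _ i else qe_rcf.Const c`_(i - n)) f0).
have chiE (z : 'rV[K]_n) : sa_holds z chi <-> q (seq_of_row z ++ c).
  rewrite chiP (@eval_fsub _ _ _ _ (seq_of_row z ++ c)) // => i.
  by rewrite nth_cat size_seq_of_row; case: ifP.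
have loc (z : 'rV[K]_n) : sa_holds z phi -> exists2 r : K, 0 < r &
    forall u : 'rV[K]_n, sa_holds u phi -> (forall i, `|u ord0 i - z ord0 i| < r) ->
      (sa_holds u chi <-> sa_holds z chi).
  move=> Sz; apply: contrapT => nr; apply: nojump; exists (seq_of_row z).
  rewrite size_seq_of_row; split=> //; split; first by rewrite row_of_seqK.
  move=> [r [r0 H]]; apply: nr; exists r => // u Su uz; apply: contrapT => nq.
  apply: H; exists (seq_of_row u); rewrite size_seq_of_row; split=> //.
  apply/jumpsE; rewrite ?size_seq_of_row //; split; first by rewrite row_of_seqK.
    by move=> i ni; rewrite !(nth_seq_of_row _ (Ordinal ni)).
  by rewrite -!chiE.
apply: S_conn; rewrite S_phi; exists (sa_set (SAand phi chi)), (sa_set (SAand phi (SAnot chi))).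
split.
- by split; eexists.
- split; [exists (row_of_seq n x)|exists (row_of_seq n y)]; apply/andP; split.
  + by move: Sx; rewrite row_of_seq_cat.
  + by apply/chiE; rewrite seq_of_rowK.
  + by move: Sy; rewrite row_of_seq_cat.
  + by apply/negP => /chiE; rewrite seq_of_rowK.
- split; apply: relatively_open_ball => [z /andP[] //|z /andP[Sz chiz]].
    have [r r0 Hr] := loc z Sz; exists r => // u Su uz; apply/andP; split=> //.
    exact/(Hr u Su uz).
  have [r r0 Hr] := loc z Sz; exists r => // u Su uz; apply/andP; split=> //.
  by apply/negP => /(Hr u Su uz); apply/negP.
- by apply/seteqP; split=> // z [/andP[_ h] /andP[_ /negP]].
apply/seteqP; split=> [z [] /andP[] //|z Sz].
by have [h|h] := boolP (sa_holds z chi); [left|right]; apply/andP.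
Qed.
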